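(* Let $p=(p(n),\,n\in\mathbb{N})$ be a probability distribution on $\mathbb{N}$ with $p(0)>0$, $p(0)+p(1)<1$ and $\sum_{n\ge 0} n\,p(n)=1$. Let $\tau$ be a (critical) Galton-Watson tree with offspring distribution $p$, and let $\tau^*$ be the associated Kesten's tree. Let $A(\tau)$ denote the number of protected nodes of $\tau$, and let $\tau_n$ be a random tree distributed as $\tau$ conditionally given $\{A(\tau)=n\}$. Then $$\lim_{n\to+\infty}\mathrm{dist}(\tau_n)=\mathrm{dist}(\tau^* ),$$ i.e. $\tau_n$ converges in distribution to $\tau^*$ for the local topology on trees.
   Context: $\mathbb{N}=\{0,1,2,\dots\}$, $\mathbb{N}^*=\{1,2,\dots\}$. Trees. $\mathcal{U}=\bigcup_{n\ge 0}(\mathbb{N}^* )^n$ is the set of finite words of positive integers (with $(\mathbb{N}^* )^0=\{\emptyset\}$); $|u|$ is the length of $u$, $uv$ is concatenation. A tree $\mathbf{t}$ is a subset of $\mathcal{U}$ containing $\emptyset$ (the root), closed under taking prefixes (ancestors), and such that for every $u\in\mathbf{t}$ there is $k_u(\mathbf{t})\in\mathbb{N}$ (the number of children of $u$) such that for $i\in\mathbb{N}^*$, $ui\in\mathbf{t}$ iff $1\le i\le k_u(\mathbf{t})$. Set $k_u(\mathbf{t})=-1$ if $u\notin\mathbf{t}$. $\mathbb{T}$ is the set of trees. A leaf is a vertex $u\in\mathbf{t}$ with $k_u(\mathbf{t})=0$. A vertex $u\in\mathbf{t}$ is a protected node if $u$ is not a leaf and none of its children $ui$, $1\le i\le k_u(\mathbf{t})$,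 is a leaf. Local topology. A sequence $(\mathbf{t}_n)$ in $\mathbb{T}$ converges locally to $\mathbf{t}\in\mathbb{T}$ iff $\lim_n k_u(\mathbf{t}_n)=k_u(\mathbf{t})$ for all $u\in\mathcal{U}$. $\mathrm{dist}(T)$ is the distribution of the $\mathbb{T}$-valued random variable $T$, and $\lim_n\mathrm{dist}(T_n)=\mathrm{dist}(T)$ means convergence in distribution with respect to this topology. Galton-Watson tree. A Galton-Watson tree with offspring distribution $p$ is the usual random element of $\mathbb{T}$ in which vertices have independent numbers of children with law $p$. Kesten's tree. With $p^*(n)=n\,p(n)/\mu$, where $\mu=\sum_n n\,p(n)$ (here $\mu=1$), Kesten's tree $\tau^*$ is the infinite random tree with a unique infinite sequence $(v_k)_{k\ge1}$ of positive integers such that $v_1\cdots v_h\in\tau^*$ for all $h\in\mathbb{N}$ (the word being $\emptyset$ if $h=0$), whose joint law with $(v_k)$ is given recursively: for each $h\in\mathbb{N}$, conditionally given $(v_1,\dots,v_h)$ and $\{u\in\tau^*:|u|\le h\}$, the numbers of children $(k_u(\tau^* ),\,u\in\tau^*,|u|=h)$ are independent, with law $p$ if $u\ne v_1\cdots v_h$ and law $p^*$ if $u=v_1\cdots v_h$; and given $\{u\in\tau^*:|u|\le h+1\}$ and $(v_1,\dots,v_h)$, $v_{h+1}$ is uniform on $\{1,\dots,k_{v_1\cdots v_h}(\tau^* )\}$. *)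

(* Defs.v *)
From HB Require Import structures.
From mathcomp Require Import all_boot all_order all_algebra.
From mathcomp Require Import all_classical all_reals all_analysis.
Set Implicit Arguments.
Unset Strict Implicit.
Unset Printing Implicit Defensive.
Import Order.TTheory GRing.Theory Num.Theory.
Import numFieldNormedType.Exports.
Local Open Scope classical_set_scope.
Local Open Scope ring_scope.

(* Words are sequences of natural numbers.  The third condition only allows
   letters i >= 1, so with prefix closure every word of a tree is a word of
   positive integers. *)
Definition is_tree (t : set (seq nat)) : Prop :=
  [/\ t [::],
      forall u w, prefix u w -> t w -> t u
    & forall u, t u ->
        exists k : nat, forall i : nat, t (rcons u i) <-> (1 <= i <= k)%N].

Record tree := Tree { vertices :> seq nat -> Prop; treeP : is_tree vertices }.

Lemma is_tree_root : is_tree [set [::]].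
Proof.
split=> // [u w /prefixP[s ->] /= |u /= ->].
  by case: u.
exists 0%N => i; split => [//|/andP[i1 i0]].
by move: (leq_trans i1 i0).
Qed.

HB.instance Definition _ := gen_eqMixin tree.
HB.instance Definition _ := gen_choiceMixin tree.
HB.instance Definition _ := isPointed.Build tree (Tree is_tree_root).

Definition nchild (t : tree) (u : seq nat) : int :=
  if `[< t u >] then
    Posz (xget 0%N [set k : nat | forall i, t (rcons u i) <-> (1 <= i <= k)%N])
  else -1.

Definition leaf (t : tree) (u : seq nat) : Prop := t u /\ nchild t u = 0.

Definition protected_node (t : tree) (u : seq nat) : Prop :=
  [/\ t u, ~ leaf t u
    & forall i : nat, (1 <= i)%N && (i%:Z <= nchild t u) -> ~ leaf t (rcons u i)].

(* The number of protected nodes may be infinite, hence a predicate. *)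
Definition nb_protected_eq (t : tree) (n : nat) : Prop :=
  ([set u | protected_node t u] #= `I_n)%card.

(* The local topology: the coarsest one making every t |-> nchild t u
   continuous, for the discrete topology on the integers. *)
Definition nchild_ptws (t : tree) : {ptws seq nat -> discrete_topology int} :=
  nchild t.

HB.instance Definition _ :=
  Topological.copy tree (initial_topology nchild_ptws).

HB.instance Definition _ :=
  Measurable.copy tree (g_sigma_algebraType (@open tree)).

Section local_limits.
Context {R : realType}.

Definition cvg_in_law (nu : nat -> probability tree R)
    (nu_lim : probability tree R) : Prop :=
  forall f : tree -> R, continuous f -> bounded_fun f ->
    \int[nu n]_t f t @[n --> \oo] --> \int[nu_lim]_t f t.

Definition cprob d (Omega : measurableType d) (P : probability Omega R)
    (A B : set Omega) : R :=
  fine (P (A `&` B)) / fine (P B).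

Definition mean (p : nat -> R) : R := limn (series (fun n => n%:R * p n)).

Definition size_biased (p : nat -> R) (n : nat) : R := n%:R * p n / mean p.

Definition trunc (h : nat) (t : tree) : set (seq nat) :=
  [set u | t u /\ (size u <= h)%N].

Definition generation (h : nat) (t : tree) : set (seq nat) :=
  [set u | t u /\ size u = h].

(* Given the vertices of height at most h, the numbers of children of the
   vertices of height h are independent with law p.  The conditioning variable
   takes countably many values, so it is enough to condition on the atoms of
   positive probability. *)
Definition galton_watson (p : nat -> R) d (Omega : measurableType d)
    (P : probability Omega R) (tau : {mfun Omega >-> tree}) : Prop :=
  forall (h : nat) (s : tree) (m : seq nat -> nat),
    let past := [set w | trunc h (tau w) = trunc h s] in
    P past != 0%E ->
    cprob P [set w | forall u, generation h s u -> nchild (tau w) u = m u] past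
    = \big[*%R/1%R]_(u \in generation h s) p (m u).

(* [v k] is the (k+1)-st letter of the spine. *)
Definition spine d (Omega : measurableType d)
    (v : nat -> {mfun Omega >-> nat}) (h : nat) (w : Omega) : seq nat :=
  mkseq (fun k => v k w) h.

Record kesten_tree (p : nat -> R) d (Omega : measurableType d)
    (P : probability Omega R) (tau : {mfun Omega >-> tree})
    (v : nat -> {mfun Omega >-> nat}) : Prop := {
  kesten_spine : {ae P, forall w,
    (forall h, tau w (spine v h w)) /\
    (forall v' : nat -> nat, (forall h, tau w (mkseq v' h)) ->
       forall k, v' k = v k w)};
  kesten_children : forall (h : nat) (s : tree) (x : seq nat)
      (m : seq nat -> nat),
    let past := [set w | trunc h (tau w) = trunc h s /\ spine v h w = x] in
    P past != 0%E ->
    cprob P [set w | forall u, generation h s u -> nchild (tau w) u = m u] past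
    = \big[*%R/1%R]_(u \in generation h s)
        (if u == x then size_biased p (m u) else p (m u));
  kesten_next : forall (h : nat) (s : tree) (x : seq nat) (i : nat),
    let past := [set w | trunc h.+1 (tau w) = trunc h.+1 s /\
                         spine v h w = x] in
    P past != 0%E ->
    cprob P [set w | v h w = i] past
    = if (1 <= i)%N && (i%:Z <= nchild s x) then (nchild s x)%:~R^-1 else 0
}.

(* When the conditioning event has probability 0, no constraint is put on the
   law of [tau_n]. *)
Definition conditioned_on_protected d (Omega : measurableType d)
    (P : probability Omega R) (tau : {mfun Omega >-> tree}) (n : nat)
    d' (Omega' : measurableType d') (P' : probability Omega' R)
    (tau_n : {mfun Omega' >-> tree}) : Prop :=
  let event := [set w | nb_protected_eq (tau w) n] in
  P event != 0%E ->
  forall B : set tree, measurable B ->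
    distribution P' tau_n B = (cprob P (tau @^-1` B) event)%:E.

End local_limits.

(* Main.v *)
(* Let [a n] be the probability that the Galton-Watson tree has [n] protected
   nodes.  If the tree agrees with a given tree up to height [h], fix all its
   subtrees at height [h] but one, which is left free: this is a finite tree [c]
   with a hole, and it contributes [weight c * a (n - nprot c)] to the
   probability that the tree lies in the ball and has [n] protected nodes.  The
   contributions of finitely many [c] are disjoint for large [n], and the weights
   of all [c] add up to the probability of the ball for Kesten's tree.  So the
   theorem follows from [limsup a (n + 1) / a n <= 1]: lower bounds for the
   probabilities of balls are enough, as these sum up to 1 in the limit.

   For the ratio, take two trees [bistar] and [comb] of the same size and the same
   weight, with one and no protected node.  Replacing a fringe subtree [comb] by
   [bistar] keeps the weight and adds one protected node, so that, with [N] and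
   [N'] the numbers of fringe subtrees [comb] and [bistar], the mean of
   [N' / (N + N')] on [n + 1] protected nodes equals the mean of [N / (N + N')] on
   [n] protected nodes.  An exponential tilting shows that [N] and [N'] are nearly
   equal, except with probability [O(x ^ -n)] for some [x > 1].  This error is
   negligible: [a] is supermultiplicative up to constants, and criticality forces
   [sum_n a n * y ^ n] to diverge for all [y > 1]. *)
Require Import Defs.
From mathcomp Require Import all_boot all_order all_algebra.
From mathcomp Require Import all_classical all_reals all_analysis.
From mathcomp Require Import measurable_realfun.
From mathcomp Require Import zify ring lra.
From HB Require Import structures.
Set Implicit Arguments.
Unset Strict Implicit.
Unset Printing Implicit Defensive.
Import Order.TTheory GRing.Theory Num.Theory.
Import numFieldNormedType.Exports.
Local Open Scope classical_set_scope.
Local Open Scope ring_scope.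

(** * Sums of nonnegative functions over a countable type *)

(** Sums take values in the extended reals, so they can be rearranged before being known to be
    finite; [psum_fin] recovers a real value from a bound. *)
Definition psum (R : realType) (T : choiceType) (f : T -> R) : \bar R :=
  \esum_(t in [set: T]) (f t)%:E.

Section psum.
Context {R : realType}.
Implicit Types T : choiceType.

Lemma psum_ge0 T (f : T -> R) : (forall t, 0 <= f t) -> (0 <= psum f)%E.
Proof. by move=> f0; apply: esum_ge0 => t _; rewrite lee_fin. Qed.

Lemma eq_psum T (f g : T -> R) : f =1 g -> psum f = psum g.
Proof. by move=> fg; apply: eq_esum => t _; rewrite fg. Qed.

Lemma le_psum T (f g : T -> R) : (forall t, f t <= g t) -> (psum f <= psum g)%E.
Proof. by move=> fg; apply: le_esum => t _; rewrite lee_fin. Qed.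

Lemma psumD T (f g : T -> R) : (forall t, 0 <= f t) -> (forall t, 0 <= g t) ->
  psum (fun t => f t + g t) = (psum f + psum g)%E.
Proof.
move=> f0 g0; rewrite /psum -esumD => [//|i _|i _]; by rewrite lee_fin.
Qed.

Lemma psum0 T : psum (fun _ : T => 0) = 0%E :> \bar R.
Proof. exact: esum1. Qed.

Lemma sum_le_psum T (f : T -> R) (r : seq T) : (forall t, 0 <= f t) ->
  uniq r -> ((\sum_(t <- r) f t)%:E <= psum f)%E.
Proof.
move=> f0 ur; apply: esum_ge; exists [set` r]; first by split.
by rewrite -fsbig_seq//= sumEFin.
Qed.

Lemma psum_le T (f : T -> R) (M : \bar R) :
  (forall r : seq T, uniq r -> ((\sum_(t <- r) f t)%:E <= M)%E) -> (psum f <= M)%E.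
Proof.
move=> fM; apply: ge_ereal_sup => _ [X [finX _] <-].
by rewrite fsbig_finite//= sumEFin; exact: fM.
Qed.

Lemma psum_gt T (f : T -> R) (c : \bar R) : (c < psum f)%E ->
  exists2 r : seq T, uniq r & (c < (\sum_(t <- r) f t)%:E)%E.
Proof.
move=> /ereal_sup_gt[_ [X [finX _] <-]].
by rewrite fsbig_finite//= sumEFin => h; exists (finmap.enum_fset (fset_set X)).
Qed.

Lemma term_le_psum T (f : T -> R) t : (forall t, 0 <= f t) ->
  ((f t)%:E <= psum f)%E.
Proof.
by move=> f0; have := @sum_le_psum _ f [:: t] f0 isT; rewrite big_seq1.
Qed.

Lemma psumZ T (f : T -> R) (c : R) : 0 <= c ->
  psum (fun t => c * f t) = (c%:E * psum f)%E.
Proof.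
move=> c0; rewrite /psum /esum -ereal_supZl//.
- congr ereal_sup; apply/seteqP; split => x /=.
    move=> [X [finX XT] <-]; exists (\sum_(i \in X) (f i)%:E)%E.
      by exists X.
    by rewrite !fsbig_finite//= !sumEFin -EFinM mulr_sumr.
  move=> [_ [X [finX XT] <-] <-]; exists X => //.
  by rewrite !fsbig_finite//= !sumEFin -EFinM mulr_sumr.
- apply/set0P; exists 0%E; exists set0; first by split.
  by rewrite fsbig_set0.
Qed.

Lemma psum_pair T1 T2 (f : T1 * T2 -> R) : (forall z, 0 <= f z) ->
  psum f = \esum_(a in [set: T1]) psum (fun b => f (a, b)).
Proof.
move=> f0; rewrite /psum.
rewrite (@esum_esum _ _ _ setT (fun=> setT) (fun a b => (f (a, b))%:E)).
- by rewrite (_ : _ `*`` _ = setT); [apply: eq_esum => -[]|apply/seteqP; split].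
- by move=> i j _ _; rewrite lee_fin.
Qed.

Lemma psum_exchange T1 T2 (f : T1 -> T2 -> R) : (forall x y, 0 <= f x y) ->
  \esum_(a in [set: T1]) psum (f a) =
  \esum_(b in [set: T2]) psum (fun a => f a b).
Proof.
move=> f0.
rewrite -(@psum_pair _ _ (fun z => f z.1 z.2))// -(@psum_pair _ _ (fun z => f z.2 z.1))//.
rewrite /psum (reindex_esum setT setT (fun z : T2 * T1 => (z.2, z.1)))//.
split=> //.
- by move=> [a b] [c d] _ _ /= [-> ->].
- by move=> [a b] _; exists (b, a).
Qed.

Lemma psum_delta T (a : T) (x : R) : 0 <= x ->
  psum (fun t => x * (t == a)%:R) = x%:E.
Proof.
move=> x0; rewrite -[RHS](@esum_set1 R T a (fun=> x%:E)) ?lee_fin//.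
rewrite esum_mkcond; apply: eq_esum => t _.
case: ifPn => [|]; first by rewrite inE/= => ->; rewrite eqxx mulr1.
by rewrite notin_setE/= => /eqP/negbTE ->; rewrite mulr0.
Qed.

(** Each [f t] is itself a sum over [b] with a single nonzero term, at [b = e t]; the two sums are
    then exchanged. *)
Lemma psum_fiber T1 T2 (e : T1 -> T2) (f : T1 -> R) : (forall t, 0 <= f t) ->
  psum f = \esum_(b in [set: T2]) psum (fun a => f a * (b == e a)%:R).
Proof.
move=> f0; rewrite -psum_exchange; last first.
  by move=> x y; apply: mulr_ge0.
by apply: eq_esum => t _; rewrite psum_delta.
Qed.

Lemma psum_prod T1 T2 (f : T1 -> R) (g : T2 -> R) :
  (forall t, 0 <= f t) -> (forall t, 0 <= g t) ->
  psum (fun z => f z.1 * g z.2) = (psum f * psum g)%E.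
Proof.
move=> f0 g0; rewrite psum_pair; last by move=> z; exact: mulr_ge0.
transitivity (\esum_(a in [set: T1]) ((f a)%:E * psum g))%E.
  by apply: eq_esum => a _; rewrite -psumZ.
have : (0 <= psum g)%E by exact: psum_ge0.
case: (psum g) => [r|_|//].
  rewrite lee_fin => r0; rewrite muleC -psumZ//.
  by apply: eq_esum => a _; rewrite -EFinM mulrC.
have [fz|/existsNP[a /eqP fa]] := pselect (forall a, f a = 0).
  rewrite esum1; last by move=> i _; rewrite fz mul0e.
  by rewrite (eq_psum fz) psum0 mul0e.
have fa0 : 0 < f a by rewrite lt_def fa f0.
rewrite gt0_muley; last first.
  by apply: lt_le_trans (term_le_psum a f0); rewrite lte_fin.
apply/eqP; rewrite -leye_eq; apply: esum_ge; exists [set a]; first by split.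
by rewrite fsbig_set1 gt0_muley ?lte_fin.
Qed.

(** Serves to bound a mass from below through an injection between weighted trees. Since [f]
    vanishes off [P], injectivity of [e] is only asked there. *)
Lemma psum_inj_le T1 T2 (P : pred T1) (e : T1 -> T2) (f : T1 -> R) (g : T2 -> R) :
  (forall t, 0 <= g t) -> {in P &, injective e} ->
  (forall t, P t -> f t <= g (e t)) -> (forall t, ~~ P t -> f t = 0) ->
  (psum f <= psum g)%E.
Proof.
move=> g0 einj fg fP; apply: psum_le => r ur.
apply: le_trans (@sum_le_psum _ g [seq e t | t <- r & P t] g0 _); last first.
  rewrite map_inj_in_uniq ?filter_uniq// => x y.
  by rewrite !mem_filter => /andP[Px _] /andP[Py _]; exact: einj.
rewrite lee_fin big_map big_filter (bigID P)/= [X in _ + X]big1 ?addr0 => [|t /fP//].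
by apply: ler_sum => t /fg.
Qed.

Lemma psum_bij T1 T2 (e : T1 -> T2) (f : T1 -> R) (g : T2 -> R) :
  bijective e -> f =1 g \o e -> psum f = psum g.
Proof.
move=> bije fge; rewrite /psum (reindex_esum setT setT e).
  by apply: eq_esum => t _; rewrite fge.
split=> //; first by move=> x y _ _; exact: (bij_inj bije).
by case: bije => e' _ ee' y _; exists (e' y).
Qed.

Lemma psum_seq T (f : seq T -> R) : (forall l, 0 <= f l) ->
  psum f = ((f [::])%:E + psum (fun z : T * seq T => f (z.1 :: z.2)))%E.
Proof.
move=> f0; rewrite {1}/psum (esumID [set [::]]); last by move=> *; rewrite lee_fin.
rewrite setTI esum_set1 ?lee_fin//; congr (_ + _)%E.
rewrite (reindex_esum [set: T * seq T] (setT `&` ~` [set [::]])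
  (fun z => z.1 :: z.2))//; split.
- by move=> [a l] _ /=; split.
- by move=> [a b] [c d] _ _ /= [-> ->].
- by move=> [|a l] [_ /=]// _; exists (a, l).
Qed.

Lemma psum_sum T (I : Type) (r : seq I) (f : I -> T -> R) :
  (forall i t, 0 <= f i t) ->
  psum (fun t => \sum_(i <- r) f i t) = (\sum_(i <- r) psum (f i))%E.
Proof.
move=> f0; elim: r => [|i r IH].
  by rewrite big_nil -[RHS](psum0 T); apply: eq_psum => t; rewrite big_nil.
rewrite big_cons -IH -psumD//; last by move=> t; apply: sumr_ge0.
by apply: eq_psum => t; rewrite big_cons.
Qed.

Lemma psum_big_seq T (v : T -> R) (V : R) (k : nat) : (forall t, 0 <= v t) ->
  psum v = V%:E ->
  psum (fun l : seq T => (\prod_(t <- l) v t) * (k == size l)%:R) = (V ^+ k)%:E.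
Proof.
move=> v0 vV; have pv0 (l : seq T) : 0 <= \prod_(t <- l) v t by exact: prodr_ge0.
elim: k => [|k IH]; rewrite psum_seq; try by move=> l; apply: mulr_ge0.
  rewrite big_nil mulr1/= -[RHS]adde0; congr (_ + _)%E.
  by rewrite -[RHS](psum0 (T * seq T)%type); apply: eq_psum => z /=; rewrite mulr0.
rewrite big_nil mulr0 add0e exprS EFinM -IH -vV -psum_prod//; last first.
  by move=> l; apply: mulr_ge0.
by apply: eq_psum => z; rewrite big_cons/= eqSS mulrA.
Qed.

(** Sort the sequences by length: those of length [k] contribute [c k * V ^+ k]. For trees this
    becomes the branching recursion. *)
Lemma psum_seq_size T (v : T -> R) (V : R) (c : nat -> R) :
  (forall t, 0 <= v t) -> (forall n, 0 <= c n) -> psum v = V%:E ->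
  psum (fun l : seq T => c (size l) * \prod_(t <- l) v t) =
  psum (fun k => c k * V ^+ k).
Proof.
move=> v0 c0 vV; have pv0 (l : seq T) : 0 <= \prod_(t <- l) v t by exact: prodr_ge0.
rewrite (psum_fiber size); last by move=> t; apply: mulr_ge0.
apply: eq_esum => k _; rewrite EFinM -(psum_big_seq k v0 vV) -psumZ//.
by apply: eq_psum => l; have [->|] := eqVneq k (size l); rewrite ?mulr1// !mulr0.
Qed.

Lemma psum_fin T (f : T -> R) (M : R) : (forall t, 0 <= f t) ->
  (psum f <= M%:E)%E -> exists2 V, psum f = V%:E & 0 <= V <= M.
Proof.
move=> f0; have := psum_ge0 f0; case: (psum f) => [V| |]//.
by rewrite !lee_fin => V0 VM; exists V => //; rewrite V0.
Qed.

Lemma series_psum (f : nat -> R) (l : R) : (forall n, 0 <= f n) ->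
  series f @ \oo --> l -> psum f = l%:E.
Proof.
move=> f0 fl; rewrite /psum -nneseries_esumT; last by move=> n; rewrite lee_fin.
apply/cvg_lim => //.
rewrite [X in X @ _ --> _](_ : _ = EFin \o series f).
  by apply: cvg_EFin; [exact: nearW|exact: fl].
by apply/funext => n; rewrite /= /series /= -sumEFin.
Qed.

Lemma psum_geometric (z : R) : 0 <= z < 1 ->
  psum (fun n => z ^+ n) = ((1 - z)^-1)%:E.
Proof.
move=> /andP[z0 z1]; apply: series_psum; first by move=> n; exact: exprn_ge0.
have -> : (fun n => z ^+ n) = geometric 1 z.
  by apply/funext => n; rewrite /geometric /= mul1r.
by have := @cvg_geometric_series R 1 z; rewrite div1r ger0_norm// => /(_ z1).
Qed.

End psum.

(** * Finite ordered trees *)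

Inductive ftree := Node of seq ftree.

(** The encoding makes [ftree] a countable type; its numbering [pickle] later reduces countably many
    balls to finitely many. *)
Fixpoint gentree_of_ftree (t : ftree) : GenTree.tree unit :=
  let: Node l := t in GenTree.Node 0 (map gentree_of_ftree l).

Fixpoint ftree_of_gentree (t : GenTree.tree unit) : ftree :=
  match t with
  | GenTree.Leaf _ => Node [::]
  | GenTree.Node _ l => Node (map ftree_of_gentree l)
  end.

Lemma gentree_of_ftreeK : cancel gentree_of_ftree ftree_of_gentree.
Proof.
rewrite /cancel; fix IH 1; case=> l /=; congr Node.
by elim: l => //= t l ->; rewrite IH.
Qed.

HB.instance Definition _ := Countable.copy ftree (can_type gentree_of_ftreeK).

(** The generated principle gives no hypothesis on the children, which are nested inside a list. *)
Lemma ftree_ind' (P : ftree -> Prop) :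
  (forall l, {in l, forall t, P t} -> P (Node l)) -> forall t, P t.
Proof.
move=> PN; fix IH 1; case=> l; apply: PN.
elim: l => [u|t l IHl u]; first by rewrite in_nil; clear IH.
by rewrite inE => /predU1P[->|/IHl].
Qed.

Definition kids (t : ftree) : seq ftree := let: Node l := t in l.

Lemma kidsK : cancel kids Node. Proof. by case. Qed.
Lemma NodeK : cancel Node kids. Proof. by []. Qed.
Lemma Node_inj : injective Node. Proof. exact: can_inj NodeK. Qed.

Definition fleaf : ftree := Node [::].

Fixpoint nprot (t : ftree) : nat :=
  let: Node l := t in
  ((l != [::]) && (fleaf \notin l) + sumn (map nprot l))%N.

Fixpoint tsize (t : ftree) : nat := let: Node l := t in (sumn (map tsize l)).+1.

Fixpoint height (t : ftree) : nat :=
  let: Node l := t in \max_(n <- map (fun u => (height u).+1) l) n.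

(** Number of fringe subtrees of [t] equal to [r], a fringe subtree being a vertex with all its
    descendants. *)
Fixpoint occ (r t : ftree) : nat :=
  let: Node l := t in ((Node l == r) + sumn (map (occ r) l))%N.

Lemma nprotE l :
  nprot (Node l) = ((l != [::]) && (fleaf \notin l) + \sum_(t <- l) nprot t)%N.
Proof. by rewrite /= sumnE big_map. Qed.

Lemma tsizeE l : tsize (Node l) = (\sum_(t <- l) tsize t).+1.
Proof. by rewrite /= sumnE big_map. Qed.

Lemma heightE l : height (Node l) = \max_(t <- l) (height t).+1.
Proof. by rewrite /= big_map. Qed.

Lemma occE r l : occ r (Node l) = ((Node l == r) + \sum_(t <- l) occ r t)%N.
Proof. by rewrite /= sumnE big_map. Qed.

Lemma height_lt l h : (height (Node l) < h.+1)%N = all (fun t => (height t < h)%N) l.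
Proof.
rewrite heightE; elim: l => [|t l IH]; first by rewrite big_nil.
by rewrite big_cons /= -IH !ltnS geq_max.
Qed.

Lemma tsize_kid t l : t \in l -> (tsize t < tsize (Node l))%N.
Proof. by move=> tl; rewrite tsizeE ltnS (big_rem t)//= leq_addr. Qed.

Lemma occ_small r t : (tsize t < tsize r)%N -> occ r t = 0%N.
Proof.
elim/ftree_ind': t => l IH lr; rewrite occE big_seq big1 => [|t tl].
  by case: eqP => // e; move: lr; rewrite e ltnn.
by apply: IH => //; exact: ltn_trans (tsize_kid tl) lr.
Qed.

Lemma occ_same_size r t : tsize t = tsize r -> occ r t = (t == r).
Proof.
case: t => l lr; rewrite occE big_seq big1 ?addn0// => t tl.
by apply: occ_small; rewrite -lr; exact: tsize_kid.
Qed.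

(** * Contexts: finite trees with a hole *)

Notation fctx := (seq (seq ftree * seq ftree)).

(** A context follows the path from the root to the hole; each frame holds the left and right
    siblings of the next vertex on that path. *)
Definition plug (c : fctx) (t : ftree) : ftree :=
  foldr (fun fr u => Node (fr.1 ++ u :: fr.2)) t c.

Lemma plug_cons fr c t : plug (fr :: c) t = Node (fr.1 ++ plug c t :: fr.2).
Proof. by []. Qed.

(** The child on the path is not a leaf once something other than a leaf is plugged in, so the
    siblings alone decide whether the vertex of the frame is protected. *)
Definition nprot_frame (fr : seq ftree * seq ftree) : nat :=
  ((fleaf \notin fr.1) && (fleaf \notin fr.2) +
   \sum_(t <- fr.1) nprot t + \sum_(t <- fr.2) nprot t)%N.

Definition nprot_ctx (c : fctx) : nat := \sum_(fr <- c) nprot_frame fr.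

Lemma plug_neq_leaf c t : t != fleaf -> plug c t != fleaf.
Proof.
case: c => [//|fr c] _; rewrite plug_cons; apply/eqP => /Node_inj.
by case: (fr.1).
Qed.

Lemma nprot_plug c t : t != fleaf -> nprot (plug c t) = (nprot_ctx c + nprot t)%N.
Proof.
move=> tN; elim: c => [|[l1 l2] c IH]; first by rewrite /nprot_ctx big_nil.
rewrite plug_cons nprotE big_cat big_cons /= IH.
rewrite /nprot_ctx big_cons /nprot_frame /=.
rewrite mem_cat inE !negb_or (eq_sym fleaf) plug_neq_leaf//=.
have -> : l1 ++ plug c t :: l2 != [::] by case: (l1).
by rewrite /=; lia.
Qed.

Lemma nprot_gt0_neq_leaf t : (0 < nprot t)%N -> t != fleaf.
Proof. by apply: contraTneq => ->. Qed.

Lemma tsize_plug c t : (tsize t + size c <= tsize (plug c t))%N.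
Proof.
elim: c => [|[l1 l2] c IH]; first by rewrite addn0.
by rewrite plug_cons tsizeE big_cat big_cons /=; lia.
Qed.

Definition occ_ctx (r : ftree) (c : fctx) : nat :=
  \sum_(fr <- c) (\sum_(t <- fr.1) occ r t + \sum_(t <- fr.2) occ r t).

(** The subtrees that properly contain the hole are larger than [t], hence than [r], and cannot
    equal [r]. *)
Lemma occ_plug r c t : tsize t = tsize r ->
  occ r (plug c t) = (occ_ctx r c + (t == r))%N.
Proof.
move=> tr; elim: c => [|[l1 l2] c IH].
  by rewrite /occ_ctx big_nil occ_same_size.
rewrite plug_cons occE; case: eqP => [/(congr1 tsize) e|_].
  have := tsize_plug ((l1, l2) :: c) t; rewrite plug_cons/= in e *.
  by rewrite e tr /=; lia.
by rewrite /occ_ctx !big_cons big_cat big_cons /= IH /occ_ctx; lia.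
Qed.

Lemma cat_cons_inj (T : eqType) (x1 x2 y1 y2 : seq T) a b :
  x1 ++ a :: x2 = y1 ++ b :: y2 ->
  [\/ [/\ x1 = y1, a = b & x2 = y2], b \in x1 | b \in x2].
Proof.
elim: x1 y1 => [|x x1 IH] [|y y1] //=.
- by case=> -> ->; apply: Or31.
- by case=> _ ->; apply: Or33; rewrite mem_cat inE eqxx orbT.
- by case=> <- _; apply: Or32; rewrite inE eqxx.
- case=> -> /IH[[-> -> ->]|b1|b2]; first exact: Or31.
    by apply: Or32; rewrite inE b1 orbT.
  exact: Or33.
Qed.

(* If the holes differ, then [t'] sits inside a side branch of [c]. *)
Lemma plug_inj c c' t t' : t' != fleaf -> size c = size c' ->
  (nprot_ctx c < nprot t')%N -> plug c t = plug c' t' -> c = c' /\ t = t'.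
Proof.
move=> t'N; elim: c c' => [|[l1 l2] c IH] [|[l1' l2'] c']//= [szc].
rewrite /nprot_ctx big_cons -/(nprot_ctx c) /nprot_frame /= => ltA.
have big u : u = plug c' t' -> (nprot t' <= nprot u)%N.
  by move=> ->; rewrite nprot_plug// leq_addl.
move=> /Node_inj /cat_cons_inj[[-> e ->]|m|m].
- by have [|-> ->//] := IH _ szc _ e; lia.
- have := big _ erefl; move: ltA; rewrite (big_rem _ m)/=; lia.
- have := big _ erefl; move: ltA; rewrite (big_rem _ m)/=; lia.
Qed.

(** * Weights of trees and contexts *)

Section weights.
Context {R : realType} (p : nat -> R).

Fixpoint weight (t : ftree) : R :=
  let: Node l := t in p (size l) * \prod_(x <- map weight l) x.

Lemma weightE l : weight (Node l) = p (size l) * \prod_(t <- l) weight t.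
Proof. by rewrite /= big_map. Qed.

Definition weight_frame (fr : seq ftree * seq ftree) : R :=
  p (size fr.1 + size fr.2).+1 *
  (\prod_(t <- fr.1) weight t * \prod_(t <- fr.2) weight t).

Definition weight_ctx (c : fctx) : R := \prod_(fr <- c) weight_frame fr.

Lemma weight_plug c t : weight (plug c t) = weight_ctx c * weight t.
Proof.
elim: c => [|[l1 l2] c IH]; first by rewrite /weight_ctx big_nil mul1r.
rewrite plug_cons weightE size_cat /= addnS big_cat big_cons /= IH.
by rewrite /weight_ctx big_cons /weight_frame /=; ring.
Qed.

Hypothesis p_ge0 : forall n, 0 <= p n.

Lemma weight_ge0 t : 0 <= weight t.
Proof.
elim/ftree_ind': t => l IH; rewrite weightE mulr_ge0// big_seq.
exact: prodr_ge0.
Qed.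

Lemma weight_ctx_ge0 c : 0 <= weight_ctx c.
Proof.
by apply: prodr_ge0 => fr _; rewrite !mulr_ge0// prodr_ge0// => t _; exact: weight_ge0.
Qed.

End weights.

(** * Pointing a tree at one of its fringe subtrees *)

Section pointing.
Context {R : realType}.

Lemma psum_ftree (f : ftree -> R) : psum f = psum (fun l => f (Node l)).
Proof.
have bijN : bijective Node by exists kids => -[].
exact: esym (psum_bij bijN (fun=> erefl)).
Qed.

Lemma psum_seq_pair (T U : choiceType) (f : seq T * U -> R) :
  (forall z, 0 <= f z) ->
  psum f = (psum (fun u => f ([::], u)) +
            psum (fun z : T * (seq T * U) => f (z.1 :: z.2.1, z.2.2)))%E.
Proof.
move=> f0; rewrite {1}/psum (esumID [set z | z.1 = [::]]); last first.
  by move=> *; rewrite lee_fin.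
rewrite setTI; congr (_ + _)%E.
  rewrite (reindex_esum [set: U] _ (fun u => ([::], u)))//; split.
  - by [].
  - by move=> a b _ _ /= [].
  - by move=> [a b] /= ->; exists b.
rewrite (reindex_esum [set: T * (seq T * U)] _
  (fun z => (z.1 :: z.2.1, z.2.2)))//; split.
- by move=> [a l] _ /=; split.
- by move=> [a [b b']] [c [d d']] _ _ /= [-> -> ->].
- by move=> [[|a l] u] [_ /=]// _; exists (a, (l, u)).
Qed.

(** Cut the children [l] around the one that holds the hole. Inductively, either that child is the
    head of [l] and the left part is empty, or the head of [l] is the head of the left part. *)
Lemma psum_split_occ (r : ftree) (l : seq ftree) :
  {in l, forall t, psum (fun c => (plug c r == t)%:R : R) = (occ r t)%:R%:E} ->
  psum (fun z : seq ftree * (seq ftree * fctx) =>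
     (z.1 ++ plug z.2.2 r :: z.2.1 == l)%:R : R) =
  (\sum_(t <- l) occ r t)%N%:R%:E.
Proof.
elim: l => [|x l IH] hl.
  rewrite big_nil -[RHS](psum0 (seq ftree * (seq ftree * fctx))%type).
  by apply: eq_psum => -[[|y l1] u].
rewrite psum_seq_pair// big_cons natrD EFinD -IH; last first.
  by move=> t tl; apply: hl; rewrite inE tl orbT.
congr (_ + _)%E.
  rewrite -hl ?mem_head// -[RHS]mul1e -(@psum_delta R _ l 1 ler01).
  rewrite -psum_prod//.
  by apply: eq_psum => -[l2 c] /=; rewrite eqseq_cons mul1r andbC -natrM mulnb.
rewrite -[RHS]mul1e -(@psum_delta R _ x 1 ler01) -psum_prod//.
by apply: eq_psum => -[y [l1 u]] /=; rewrite eqseq_cons mul1r -natrM mulnb.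
Qed.

(** The empty context accounts for the root term of [occ]; in any other one the first frame
    designates a child. *)
Lemma psum_occ (r t : ftree) :
  psum (fun c => (plug c r == t)%:R : R) = (occ r t)%:R%:E.
Proof.
elim/ftree_ind': t => l IH.
rewrite psum_seq// occE natrD EFinD eq_sym -psum_split_occ//; congr (_ + _)%E.
apply: (psum_bij (e := fun z : (seq ftree * seq ftree) * fctx =>
  (z.1.1, (z.1.2, z.2)))).
  by exists (fun z => ((z.1, z.2.1), z.2.2)) => [[[? ?] ?]|[? [? ?]]].
by move=> [[l1 l2] c] /=; rewrite (inj_eq Node_inj).
Qed.

(* The factor [occ r t] counts the contexts [c] such that [plug c r = t]. *)
Lemma psum_pointing (r : ftree) (f : ftree -> R) : (forall t, 0 <= f t) ->
  psum (fun t => (occ r t)%:R * f t) = psum (fun c => f (plug c r)).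
Proof.
move=> f0; rewrite [RHS](psum_fiber (plug^~ r))//.
apply: eq_esum => t _; rewrite mulrC EFinM -psum_occ -psumZ//.
apply: eq_psum => c; rewrite eq_sym.
by case: eqP => [->//|_]; rewrite !mulr0.
Qed.

End pointing.

(* [agree h t u]: [t] and [u] have the same vertices up to height [h]. *)
Fixpoint agree (h : nat) (t u : ftree) : bool :=
  if h is h'.+1 then all2 (agree h') (kids t) (kids u) else true.

(* Words are 1-based, as in the definition of [tree]. *)
Fixpoint fmem (t : ftree) (u : seq nat) : bool :=
  if u is i :: u' then
    (0 < i <= size (kids t))%N && fmem (nth fleaf (kids t) i.-1) u'
  else true.

(* [fits x t c]: whatever is plugged in [c], the result agrees with [t] up to
   height [size x], and the hole is at the vertex [x]. *)
Fixpoint fits (x : seq nat) (t : ftree) (c : fctx) : bool :=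
  match x, c with
  | [::], [::] => true
  | i :: x', fr :: c' =>
    [&& (0 < i <= size (kids t))%N,
        all2 (agree (size x')) (take i.-1 (kids t)) fr.1,
        all2 (agree (size x')) (drop i (kids t)) fr.2
      & fits x' (nth fleaf (kids t) i.-1) c']
  | _, _ => false
  end.

Lemma fits_size x t c : fits x t c -> size c = size x.
Proof.
by elim: x t c => [|i x IH] t [|fr c] //= /and4P[_ _ _ /IH ->].
Qed.

Lemma all2_size (T U : Type) (r : T -> U -> bool) s t : all2 r s t -> size s = size t.
Proof. by elim: s t => [|x s IH] [|y t] //= /andP[_ /IH ->]. Qed.

(** The left part of each frame has as many trees as there are siblings before the path, so the
    context determines the word of its hole. *)
Lemma fits_inj x y t c : fits x t c -> fits y t c -> x = y.
Proof.
elim: x y t c => [|i x IH] [|j y] t [|fr c] //=.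
move=> /and4P[/andP[i0 il] /all2_size + _ fx] /and4P[/andP[j0 jl] /all2_size + _ fy].
rewrite !size_take !ifT; try lia.
move=> ei ej; have eij : i = j by lia.
by congr (_ :: _) => //; apply: IH fx _; rewrite eij.
Qed.

Lemma all2_catl (T U : Type) (r : T -> U -> bool) s1 s2 t1 t2 :
  all2 r s1 t1 -> all2 r s2 t2 -> all2 r (s1 ++ s2) (t1 ++ t2).
Proof. by elim: s1 t1 => [|x s1 IH] [|y t1] //= /andP[-> /IH h] /h. Qed.

Lemma kids_split t i : (0 < i <= size (kids t))%N ->
  kids t = take i.-1 (kids t) ++ nth fleaf (kids t) i.-1 :: drop i (kids t).
Proof.
case: i => // i /= it; rewrite -drop_nth ?cat_take_drop//.
Qed.

Lemma fits_agree x t c u : fits x t c -> agree (size x) t (plug c u).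
Proof.
elim: x t c => [|i x IH] t [|[l1 l2] c] //= /and4P[it h1 h2 /IH h].
by rewrite {1}(kids_split it); apply: all2_catl => //=; rewrite h.
Qed.

Lemma occ_short r t : (height t < height r)%N -> occ r t = 0%N.
Proof.
elim/ftree_ind': t => l IH lr; rewrite occE big_seq big1 => [|t tl].
  by case: eqP => // e; move: lr; rewrite e ltnn.
apply: IH => //; apply: ltn_trans lr.
by rewrite heightE (big_rem t)//= leq_max ltnSn.
Qed.

Lemma height0 t : (height t < 1)%N -> t = fleaf.
Proof.
by case: t => -[//|t l]; rewrite heightE big_cons ltnNge leq_max ltn0Sn.
Qed.

Lemma nprot_short t : (height t < 2)%N -> nprot t = 0%N.
Proof.
case: t => l; rewrite height_lt => /allP hl.
have lf : {in l, forall t, t = fleaf} by move=> t /hl /height0.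
rewrite nprotE big_seq big1 => [|t /lf -> //].
case: l lf {hl} => //= t l lf.
by rewrite (lf t) ?mem_head// inE eqxx.
Qed.

(** * Two trees of equal weight, with and without a protected node *)

Section special_trees.
Variable k : nat.
Hypothesis k_gt1 : (1 < k)%N.

Definition star : ftree := Node (nseq k fleaf).

Definition bistar : ftree := Node (nseq k star).

Fixpoint caterpillar (i : nat) : ftree :=
  if i is i'.+1 then Node (caterpillar i' :: nseq k.-1 fleaf) else fleaf.

(** Its [k.+1] inner vertices, all with [k] children, are as many as those of [bistar], so that
    sizes and weights coincide. *)
Definition comb : ftree := caterpillar k.+1.

Lemma tsize_bistar : tsize bistar = (1 + k * k.+1)%N.
Proof. by rewrite /= map_nseq sumn_nseq /= map_nseq sumn_nseq /=; lia. Qed.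

Lemma tsize_caterpillar i : tsize (caterpillar i) = (1 + k * i)%N.
Proof.
elim: i => [|i IH] /=; first by rewrite muln0.
by rewrite map_nseq sumn_nseq IH /=; nia.
Qed.

Lemma tsize_comb : tsize comb = tsize bistar.
Proof. by rewrite tsize_bistar tsize_caterpillar. Qed.

Lemma nprot_star : nprot star = 0%N.
Proof.
rewrite /= map_nseq sumn_nseq /= mul0n addn0 mem_nseq.
by rewrite eqxx andbT -leqNgt; case: (k) k_gt1.
Qed.

Lemma star_neq_leaf : star != fleaf.
Proof. by apply/eqP => /Node_inj; case: (k) k_gt1. Qed.

Lemma nprot_bistar : nprot bistar = 1%N.
Proof.
rewrite nprotE big_nseq -/(nprot star) nprot_star iter_addn mul0n !addn0.
rewrite mem_nseq (eq_sym fleaf) (negbTE star_neq_leaf) andbF /=.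
by case: (k) k_gt1.
Qed.

(** Every inner vertex has [k.-1 >= 1] leaf children besides the next vertex of the spine. *)
Lemma nprot_caterpillar i : nprot (caterpillar i) = 0%N.
Proof.
elim: i => [//|i IH].
rewrite nprotE big_cons IH big_nseq iter_addn mul0n addn0 addn0 inE mem_nseq eqxx.
have -> : (0 < k.-1)%N by lia.
by rewrite orbT.
Qed.

Lemma comb_neq_leaf : comb != fleaf.
Proof. by apply/eqP => /(congr1 (size \o kids)). Qed.

Lemma bistar_neq_leaf : bistar != fleaf.
Proof. by apply: nprot_gt0_neq_leaf; rewrite nprot_bistar. Qed.

Lemma comb_neq_bistar : comb != bistar.
Proof.
by apply/eqP => /(congr1 nprot); rewrite nprot_bistar nprot_caterpillar.
Qed.

Lemma height_bistar : height bistar = 2%N.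
Proof.
have maxS n m : iter n.+1 (maxn m) 0%N = m.
  by elim: n => [|n IH]; [rewrite /= maxn0|rewrite iterS IH maxnn].
have maxk m : iter k (maxn m) 0%N = m by case: (k) k_gt1.
rewrite heightE big_nseq maxk heightE big_nseq maxk.
by rewrite heightE big_nil.
Qed.

Lemma height_caterpillar i : (i <= height (caterpillar i))%N.
Proof.
elim: i => // i IH; rewrite heightE big_cons leq_max.
by apply/orP; left.
Qed.

Lemma height_comb : (2 <= height comb)%N.
Proof. by apply: leq_trans (height_caterpillar _); lia. Qed.

Section weights.
Context {R : realType} (p : nat -> R).

Lemma weight_leaf : weight p fleaf = p 0.
Proof. by rewrite weightE big_nil mulr1. Qed.

Lemma weight_star : weight p star = p k * p 0 ^+ k.
Proof.
by rewrite weightE size_nseq big_nseq weight_leaf iter_mulr mulr1.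
Qed.

Lemma weight_bistar : weight p bistar = p k ^+ k.+1 * p 0 ^+ (k * k).
Proof.
rewrite weightE size_nseq big_nseq iter_mulr mulr1 weight_star.
by rewrite exprMn exprS -exprM mulrA.
Qed.

Lemma weight_comb : weight p comb = weight p bistar.
Proof.
have wc i : weight p (caterpillar i) = p k ^+ i * p 0 ^+ (1 + i * k.-1).
  elim: i => [|i IH]; first by rewrite weight_leaf mul0n addn0 expr1 mul1r.
  rewrite weightE big_cons IH /= size_nseq prednK; last by lia.
  rewrite big_nseq iter_mulr mulr1 weight_leaf mulSn addnCA [X in _ = _ * X]exprD (exprS (p k)).
  by set a := p 0 ^+ _; set b := p 0 ^+ _; set c := p k ^+ _; ring.
rewrite weight_bistar wc; congr (_ * _ ^+ _); nia.
Qed.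

End weights.
End special_trees.

(** A finite family of trees has bounded height, so sums over all trees can be bounded by induction
    on the height. *)
Lemma psum_height_le (R : realType) (f : ftree -> R) h0 (M : \bar R) : (forall t, 0 <= f t) ->
  (forall h, (h0 <= h)%N -> (psum (fun t => f t * (height t < h)%:R)%R <= M)%E) ->
  (psum f <= M)%E.
Proof.
move=> f0 fM; apply: psum_le => r ur.
pose h := maxn h0 (\max_(t <- r) (height t).+1).
apply: le_trans (fM h (leq_maxl _ _)).
apply: le_trans (sum_le_psum _ ur); last by move=> t; rewrite mulr_ge0.
rewrite lee_fin big_seq [leRHS]big_seq; apply: ler_sum => t tr.
have -> : (height t < h)%N.
  by rewrite /h leq_max (big_rem t)//= leq_max leqnn orbT.
by rewrite mulr1.
Qed.

Lemma prod_indicator (R : realType) (l : seq ftree) (P : pred ftree) :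
  \prod_(t <- l) (P t)%:R = (all P l)%:R :> R.
Proof.
elim: l => [|t l IH]; first by rewrite big_nil.
by rewrite big_cons IH -natrM mulnb.
Qed.

Lemma eventually_all (T : eqType) (r : seq T) (Q : T -> nat -> Prop) :
  (forall c, exists N, forall n, (N <= n)%N -> Q c n) ->
  exists N, forall n, (N <= n)%N -> {in r, forall c, Q c n}.
Proof.
move=> hQ; elim: r => [|c r [N hN]]; first by exists 0%N.
have [N' hN'] := hQ c; exists (maxn N N') => n; rewrite geq_max => /andP[nN nN'] d.
by rewrite inE => /predU1P[->|]; [exact: hN'|exact: hN].
Qed.

(** * Elementary inequalities over the reals *)

Section real_lemmas.
Context {R : realType}.

Lemma bernoulli_expr (V : R) n : 0 <= V -> 1 + n%:R * V <= V ^+ n + n%:R.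
Proof.
move=> V0; elim: n => [|n IH]; first by rewrite expr0 mul0r.
have n0 : (0 : R) <= n%:R by [].
rewrite exprS -natr1.
have := ler_wpM2l V0 IH; have := mulr_ge0 n0 (sqr_ge0 (V - 1)); nra.
Qed.

(** The function [V ^+ n] lies above its tangent line at 1, with a quadratic gain as soon as
    [n > 1]. The gain later separates the offspring generating function from the diagonal. *)
Lemma bernoulli_expr2 (V : R) n : 0 <= V -> (1 < n)%N ->
  1 + n%:R * V + (1 - V) ^+ 2 <= V ^+ n + n%:R.
Proof.
move=> V0; case: n => [//|[//|n _]]; elim: n => [|n IH]; first by nra.
have n0 : (0 : R) <= n%:R by [].
rewrite [V ^+ _]exprS; move: IH; set Y := V ^+ n.+2; rewrite -!natr1 => IH.
have := ler_wpM2l V0 IH.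
have := mulr_ge0 (addr_ge0 n0 V0) (sqr_ge0 (V - 1)).
have := sqr_ge0 (V - 1); lra.
Qed.

Lemma expr_le_inv_quad (d : R) n : 0 <= d -> n%:R * d <= 1 ->
  (1 + d) ^+ n <= 1 + n%:R * d + (n%:R * d) ^+ 2.
Proof.
move=> d0; elim: n => [|n IH]; first by rewrite expr0 mul0r addr0 expr0n addr0.
rewrite exprS -natr1 => nd1; have n0 : (0 : R) <= n%:R by [].
have {}IH := IH _; have nd : n%:R * d <= 1 by nra.
have := IH nd; set Y := (1 + d) ^+ n => le1.
apply: (@le_trans _ _ ((1 + d) * (1 + n%:R * d + (n%:R * d) ^+ 2))).
  by apply: ler_wpM2l => //; lra.
have h1 : 0 <= n%:R * d by apply: mulr_ge0.
have h2 : 0 <= n%:R * d * d * (1 - n%:R * d).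
  by rewrite !mulr_ge0// subr_ge0.
have h3 : 0 <= d * d by apply: mulr_ge0.
nra.
Qed.

Section shares.
Variables (j a b W : R).
Hypotheses (j_ge1 : 1 <= j) (W_ge0 : 0 <= W) (a_ge0 : 0 <= a) (b_ge0 : 0 <= b).
Hypothesis ab_gt0 : 0 < a + b.
Let j_gt0 : 0 < j. Proof. exact: lt_le_trans j_ge1. Qed.

(** Here [a] and [b] stand for the numbers of fringe subtrees [comb] and [bistar] of a tree of
    weight [W]. The assumption gives [b / (a + b) >= j / (2 * j + 1)], whence the normalising
    factor. *)
Lemma share_ge : j * a <= (j + 1) * b ->
  W <= (2 * j + 1) / j * (b * (W / (a + b))).
Proof.
move=> ab.
have -> : (2 * j + 1) / j * (b * (W / (a + b))) =
    W * ((2 * j + 1) * b / (j * (a + b))).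
  by field; rewrite ?(gt_eqF j_gt0, gt_eqF ab_gt0).
by rewrite ler_peMr// ler_pdivlMr ?mulr_gt0//; lra.
Qed.

Lemma share_le : j * a <= (j + 1) * b ->
  (2 * j + 1) / j * (a * (W / (a + b))) <= (1 + j^-1) * W.
Proof.
move=> ab.
have -> : (2 * j + 1) / j * (a * (W / (a + b))) =
    ((2 * j + 1) * a) / (j * (a + b)) * W.
  by field; rewrite ?(gt_eqF j_gt0, gt_eqF ab_gt0).
apply: ler_wpM2r => //; rewrite ler_pdivrMr ?mulr_gt0//.
have -> : (1 + j^-1) * (j * (a + b)) = (j + 1) * (a + b).
  by field; rewrite (gt_eqF j_gt0).
by lra.
Qed.

Lemma share_le3 : (2 * j + 1) / j * (a * (W / (a + b))) <= 3 * W.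
Proof.
have -> : (2 * j + 1) / j * (a * (W / (a + b))) =
    ((2 * j + 1) * a) / (j * (a + b)) * W.
  by field; rewrite ?(gt_eqF j_gt0, gt_eqF ab_gt0).
apply: ler_wpM2r => //; rewrite ler_pdivrMr ?mulr_gt0//.
have j0 := le_trans ler01 j_ge1.
by have := mulr_ge0 j0 b_ge0; have := ler_peMl a_ge0 j_ge1; lra.
Qed.

End shares.

(** At [z = 1] the sum is 2 with derivative [j - (j + 1) = -1], so it drops below 2 just after 1. *)
Lemma exists_tilt (j : nat) : exists2 z : R, 1 < z &
  z ^+ j + (z ^+ j.+1)^-1 < 2.
Proof.
(* After multiplication by [z ^+ j.+1] the goal is [z ^+ m + 1 < 2 * z ^+ j.+1] for [z = 1 + d]. To
   first order the right side is ahead by [d], while the quadratic error is at most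
   [(m * d) ^ 2 = d / 2]. *)
pose m := (2 * j + 1)%N; pose d : R := (2 * m%:R ^+ 2)^-1.
have m1 : 1 <= m%:R :> R by rewrite ler1n /m; lia.
have d0 : 0 < d by rewrite invr_gt0; nra.
have dm : d * (2 * m%:R ^+ 2) = 1 by rewrite mulVf//; nra.
exists (1 + d); first by rewrite ltrDl.
have md : m%:R * d <= 1 by nra.
have z0 : 0 < (1 + d) ^+ j.+1 by rewrite exprn_gt0; lra.
rewrite -(ltr_pM2r z0) mulrDl mulVf ?gt_eqF// -exprD.
have -> : (j + j.+1 = m)%N by rewrite /m; lia.
have := expr_le_inv_quad (ltW d0) md.
have : 0 <= 1 + d by lra.
move=> /(bernoulli_expr j.+1).
have -> : m%:R = 2 * j%:R + 1 :> R by rewrite /m natrD natrM.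
rewrite -natr1; move: dm; rewrite (_ : m%:R = 2 * j%:R + 1); last first.
  by rewrite /m natrD natrM.
nra.
Qed.

Lemma pos_lower_bound (u : nat -> R) q : (forall n, 0 < u n) ->
  exists2 c, 0 < c & forall r, (r < q)%N -> c <= u r.
Proof.
move=> u0; elim: q => [|q [c c0 cu]]; first by exists 1.
exists (Num.min c (u q)); first by rewrite lt_min c0 u0.
by move=> r; rewrite ltnS leq_eqVlt => /predU1P[->|/cu h]; rewrite ge_min ?lexx ?orbT// h.
Qed.

End real_lemmas.

(** * The number of protected nodes of a critical tree *)

Section critical.
Context {R : realType} (p : nat -> R).
Hypothesis p_ge0 : forall n, 0 <= p n.
Hypothesis p_sum1 : psum p = 1%E.
Hypothesis p_critical : psum (fun n => n%:R * p n) = 1%E.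
Variable k : nat.
Hypothesis k_gt1 : (1 < k)%N.
Hypothesis pk_gt0 : 0 < p k.
Hypothesis p0_gt0 : 0 < p 0.

Local Notation w := (weight p).
Let w_ge0 t : 0 <= w t. Proof. exact: weight_ge0. Qed.

(** By criticality the tangent lines of the [V ^+ n] at 1, weighted by [p n], sum to [V]; the term
    [n = k] brings the quadratic gain. *)
Lemma offspring_gf_ge (V : R) : 0 <= V ->
  ((V + p k * (1 - V) ^+ 2)%:E <= psum (fun n => p n * V ^+ n)%R)%E.
Proof.
move=> V0; have V2 : 0 <= p k * (1 - V) ^+ 2 by rewrite mulr_ge0// sqr_ge0.
have pV n : 0 <= p n * V ^+ n by rewrite mulr_ge0// exprn_ge0.
have np n : 0 <= n%:R * p n by rewrite mulr_ge0.
(* The sum of the [n * p n], equal to 1, is added on both sides to avoid subtracting extended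
   reals. *)
rewrite -(@leeD2rE _ 1%E)// -{2}p_critical -psumD//.
apply: (@le_trans _ _ (psum (fun n => (p n + V * (n%:R * p n)) +
   p k * (1 - V) ^+ 2 * (n == k)%:R))).
  rewrite psumD => [|n|n]; last first.
  - by rewrite mulr_ge0.
  - by rewrite addr_ge0// mulr_ge0.
  rewrite psumD//; last by move=> n; rewrite mulr_ge0.
  rewrite psumZ// p_critical p_sum1 psum_delta// mule1 -!EFinD lee_fin; lra.
apply: le_psum => n; have [->|_] := eqVneq n k.
  have := ler_wpM2l (p_ge0 k) (bernoulli_expr2 V0 k_gt1); rewrite mulr1; lra.
have := ler_wpM2l (p_ge0 n) (bernoulli_expr n V0); rewrite mulr0; lra.
Qed.

(** A tree is a root with independent subtrees, so summing a multiplicative weight over the children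
    yields the generating function of [p] at the total weight. *)
Lemma psum_branching (v : ftree -> R) (V : R) : (forall t, 0 <= v t) ->
  psum v = V%:E ->
  psum (fun l => p (size l) * \prod_(t <- l) v t) = psum (fun n => p n * V ^+ n).
Proof. by move=> v0; exact: psum_seq_size. Qed.

Lemma offspring_gf_le1 (V : R) : 0 <= V <= 1 ->
  (psum (fun n => p n * V ^+ n)%R <= 1)%E.
Proof.
move=> /andP[V0 V1]; rewrite -p_sum1; apply: le_psum => n.
by rewrite ler_piMr// exprn_ile1.
Qed.

(** Let [g] be the generating function of [p]. Passing from height less than [h] to height less than
    [h.+1] applies [g] to the sum, and [g] maps [0, 1] into itself. *)
Lemma psum_weight_le1 : (psum w <= 1)%E.
Proof.
apply: (@psum_height_le _ _ 0) => // h _; elim: h => [|h IH].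
  rewrite (@eq_psum _ _ _ (fun=> 0)) ?psum0 ?lee01// => t.
  by rewrite ltn0 mulr0.
have v0 t : 0 <= w t * (height t < h)%:R by rewrite mulr_ge0.
have [V VE V01] := psum_fin v0 IH.
rewrite psum_ftree; apply: le_trans (offspring_gf_le1 V01).
rewrite -(psum_branching v0 VE); apply: le_psum => l.
by rewrite height_lt weightE big_split/= prod_indicator mulrA.
Qed.

(** Almost sure extinction: the total mass is a fixed point of [g], and the quadratic gain leaves 1
    as the only one. *)
Lemma psum_weight : psum w = 1%E.
Proof.
have [V VE /andP[V0 V1]] := psum_fin w_ge0 psum_weight_le1.
have := psum_branching w_ge0 VE.
rewrite (@eq_psum _ _ _ (w \o Node)); last by move=> l; rewrite /= -weightE.
rewrite -psum_ftree VE => e; have := offspring_gf_ge V0; rewrite -e lee_fin.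
rewrite gerDl => le0; have : (1 - V) ^+ 2 <= 0 by rewrite -(pmulr_rle0 _ pk_gt0).
rewrite le_eqVlt ltNge sqr_ge0 orbF sqrf_eq0 subr_eq0 => /eqP <- //.
Qed.

(** The probability [a n] of the outline; [prob_nb_protected] makes the link with the random
    tree. *)
Definition mass (n : nat) : R := fine (psum (fun t => w t * (nprot t == n)%:R)).

Lemma psum_restrict_fin (P : pred ftree) :
  psum (fun t => w t * (P t)%:R) \is a fin_num.
Proof.
have [||V -> //] := @psum_fin R _ (fun t => w t * (P t)%:R) 1.
  by move=> t; rewrite mulr_ge0.
rewrite -psum_weight; apply: le_psum => t.
by rewrite ler_piMr// lern1 leq_b1.
Qed.

Lemma massE n : psum (fun t => w t * (nprot t == n)%:R) = (mass n)%:E.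
Proof. by rewrite fineK// psum_restrict_fin. Qed.

Lemma mass_ge0 n : 0 <= mass n.
Proof. by rewrite -lee_fin -massE psum_ge0// => t; rewrite mulr_ge0. Qed.

(** * Exponential tilting by the numbers of combs and bistars *)

Section tilting.
Variables (x phi theta : R).
Hypothesis phi_ge1 : 1 <= phi.
Let phi_ge0 : 0 <= phi. Proof. exact: le_trans phi_ge1. Qed.
Hypothesis theta_ge0 : 0 <= theta.
Hypothesis theta_le1 : theta <= 1.
Hypothesis x_ge1 : 1 <= x.
Local Notation s := (comb k).
Local Notation s' := (bistar k).
Hypothesis x_small : x - 1 <= (2 - phi - theta) * w s'.

(* [psum_tilt_le1] is a Chernoff bound: under [x_small], the constant 1 is a
   supersolution of the recursion satisfied by the sums over trees of height less
   than [h]. *)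
Definition tilt (t : ftree) : R :=
  x ^+ nprot t * phi ^+ occ s t * theta ^+ occ s' t.

Lemma tiltE l : tilt (Node l) =
  x ^+ ((l != [::]) && (fleaf \notin l)) * phi ^+ (Node l == s) *
  theta ^+ (Node l == s') * \prod_(t <- l) tilt t.
Proof.
rewrite /tilt nprotE !occE !exprD !expr_sum !big_split /=; ring.
Qed.

Lemma tilt_ge0 t : 0 <= tilt t.
Proof. by rewrite !mulr_ge0// exprn_ge0// (le_trans _ x_ge1). Qed.

Lemma tilt_short t : (height t < 2)%N -> tilt t = 1.
Proof.
move=> ht; rewrite /tilt nprot_short// !occ_short ?mulr1//.
  by rewrite height_bistar.
by apply: leq_trans ht (height_comb _).
Qed.

Lemma tilt_kids_comb : \prod_(t <- kids s) tilt t = 1.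
Proof.
have tilt_cat i : (i <= k)%N -> tilt (caterpillar k i) = 1.
  move=> ik; have lt : (tsize (caterpillar k i) < tsize s)%N.
    by rewrite !tsize_caterpillar//; nia.
  rewrite /tilt nprot_caterpillar// !occ_small ?mulr1//.
  by rewrite -tsize_comb.
by rewrite big_cons tilt_cat// big_nseq iter_mulr (tilt_cat 0%N)// expr1n !mulr1.
Qed.

Lemma tilt_kids_bistar : \prod_(t <- kids s') tilt t = 1.
Proof.
rewrite big_nseq iter_mulr tilt_short ?expr1n ?mulr1//.
by rewrite height_lt; apply/allP => t /nseqP[-> _]; rewrite heightE big_nil.
Qed.

Let leaf_kids_comb : fleaf \notin kids s = false.
Proof.
have k1 : (0 < k.-1)%N by lia.
by rewrite inE mem_nseq k1 eqxx orbT.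
Qed.

Lemma psum_tilt_step h : (2 <= h)%N ->
  (psum (fun t => (w t * tilt t) * (height t < h)%:R)%R <= 1)%E ->
  (psum (fun t => (w t * tilt t) * (height t < h.+1)%:R)%R <= 1)%E.
Proof.
move=> h2 IH.
have v0 t : 0 <= w t * tilt t * (height t < h)%:R.
  by apply: mulr_ge0 => //; apply: mulr_ge0 => //; exact: tilt_ge0.
have [V VE V01] := psum_fin v0 IH.
have := psum_branching v0 VE; have := offspring_gf_le1 V01; move=> + br.
rewrite -br => {br VE V01 IH V}.
set F := (fun l => p (size l) * _) => F1.
have FE l : F l = w (Node l) * \prod_(t <- l) tilt t * (height (Node l) < h.+1)%:R.
  by rewrite weightE height_lt /F !big_split/= prod_indicator !mulrA.
have F0 l : 0 <= F l.
  rewrite FE; apply: mulr_ge0 => //; apply: mulr_ge0 => //.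
  by apply: prodr_ge0 => t _; exact: tilt_ge0.
have hs' : (height s' < h.+1)%N by rewrite height_bistar.
have x0 : 0 <= x by exact: le_trans x_ge1.
rewrite psum_ftree.
(* At an ordinary tree the root contributes a factor at most [x]; at [bistar] it contributes
   [x * theta], and at [comb], whose root is not protected, it contributes [phi]. Compensating terms
   stand on both sides to avoid subtraction. *)
have key : (psum (fun l => (w (Node l) * tilt (Node l)) * (height (Node l) < h.+1)%:R
     + x * w s' * (l == kids s')%:R + w s' * (l == kids s)%:R)%R <=
   psum (fun l => x * F l + (x * theta * w s') * (l == kids s')%:R +
      (phi * w s') * (l == kids s)%:R)%R)%E.
  apply: le_psum => l; rewrite FE tiltE.
  have [e|ns'] := eqVneq l (kids s').
    have -> : Node l = s' by rewrite e.
    rewrite e tilt_kids_bistar hs' !mulr1 eqxx (eq_sym s').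
    rewrite (negbTE (comb_neq_bistar _))//.
    have -> : kids s' != [::] by rewrite /=; case: (k) k_gt1.
    have -> : fleaf \notin kids s'.
      by rewrite mem_nseq negb_and orbC eq_sym star_neq_leaf.
    have /negbTE -> : kids s' != kids s.
      by rewrite (can_eq kidsK) eq_sym comb_neq_bistar.
    by rewrite /= !mulr1 !mulr0 !addr0 expr1; nra.
  have Nls' : Node l != s' by apply: contraNneq ns' => <-.
  have [e|ns] := eqVneq l (kids s).
    have -> : Node l = s by rewrite e.
    rewrite e tilt_kids_comb (negbTE (comb_neq_bistar _))// !mulr1 !mulr0 !addr0.
    rewrite leaf_kids_comb.
    rewrite andbF eqxx (_ : x ^+ false = 1)// (_ : phi ^+ true = phi)//.
    rewrite ?mul1r ?mulr1 weight_comb//.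
    have := ler_peMl (w_ge0 s') phi_ge1; have := ler_peMl (w_ge0 s') x_ge1.
    by case: (height s < h.+1)%N; rewrite ?(mulr1, mulr0, mul1r); lra.
  have Nls : Node l != s by apply: contraNneq ns => <-.
  rewrite (negbTE Nls) (negbTE Nls') !mulr1 !mulr0 !addr0.
  rewrite mulrCA -[leLHS]mulrA; apply: ler_wpM2r; first by rewrite -FE.
  by case: (_ && _); rewrite ?expr1// (_ : x ^+ false = 1).
have pw : 0 <= w s' := w_ge0 _.
have c1 : 0 <= x * theta * w s' by apply: mulr_ge0 => //; exact: mulr_ge0.
have c2 : 0 <= phi * w s' by exact: mulr_ge0.
have c3 : 0 <= x * w s' by exact: mulr_ge0.
have wt0 l : 0 <= w (Node l) * tilt (Node l) * (height (Node l) < h.+1)%:R.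
  by apply: mulr_ge0 => //; apply: mulr_ge0 => //; exact: tilt_ge0.
move: key; rewrite !psumD//.
all: try by move=> l; apply: mulr_ge0.
all: try by move=> l; apply: addr_ge0 => //; apply: mulr_ge0.
rewrite (psumZ F x0) !psum_delta//.
have := psum_ge0 wt0; have := psum_ge0 F0.
have := F1; case: (psum F) => [f| |]//; rewrite !lee_fin => f1 f0.
case: (psum _) => [g| |]//; rewrite ?lee_fin => g0 key; rewrite -?EFinM -?EFinD ?lee_fin in key *.
have : x * f <= x by rewrite ler_piMr.
(* The remaining inequality is [x - 1 <= (x + 1 - x * theta - phi) * w s']; its right side exceeds
   that of [x_small] by this nonnegative product. *)
have : 0 <= (x - 1) * (1 - theta) * w s'.
  by apply: mulr_ge0 => //; apply: mulr_ge0; rewrite subr_ge0.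
move: x_small key; set W := w _; nra.
Qed.

Lemma psum_tilt_le1 : (psum (fun t => w t * tilt t)%R <= 1)%E.
Proof.
(* Trees of height less than 2 contain neither special tree and have no protected node, so the
   induction starts from the untilted mass. *)
apply: (@psum_height_le _ _ 2).
  by move=> t; rewrite mulr_ge0// tilt_ge0.
elim=> [//|h IH]; rewrite ltnS leq_eqVlt => /predU1P[<-|h2]; last first.
  exact: psum_tilt_step (IH h2).
rewrite -psum_weight; apply: le_psum => t.
case: ltnP => [ht|_]; last by rewrite mulr0.
by rewrite tilt_short// !mulr1.
Qed.

End tilting.

(** * Exchange of combs and bistars *)

Local Notation s := (comb k).
Local Notation s' := (bistar k).

(** The weight is split evenly among the fringe subtrees equal to [comb] or [bistar]; a tree without
    any gets 0, as division by 0 yields 0. *)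
Let occ_share (n : nat) (t : ftree) : R :=
  w t * (nprot t == n)%:R / (occ s t + occ s' t)%:R.

(** Pointing turns both sides into sums over contexts. In a given context, [bistar] and [comb] give
    the same weight and the same total number of special fringe subtrees, and [bistar] gives one
    more protected node. *)
Lemma psum_swap n :
  psum (fun t => (occ s' t)%:R * occ_share n.+1 t) =
  psum (fun t => (occ s t)%:R * occ_share n t).
Proof.
have h0 m t : 0 <= occ_share m t by rewrite !mulr_ge0.
rewrite !psum_pointing//; apply: eq_psum => c; rewrite /occ_share.
rewrite !weight_plug weight_comb// !nprot_plug ?bistar_neq_leaf ?comb_neq_leaf//.
rewrite nprot_bistar// nprot_caterpillar// addn1 addn0 eqSS.
rewrite !occ_plug ?tsize_comb// !eqxx.
rewrite [s' == s]eq_sym (negbTE (comb_neq_bistar _))//.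
by congr (_ / _%:R); rewrite !(addn0, addn1) addSn addnS.
Qed.

(** Off the bad trees, [bistar] has a share of at least [j / (2 * j + 1)] at [n.+1] and [comb] one
    of at most [(j + 1) / (2 * j + 1)] at [n]; [psum_swap] equates the total shares. Bad trees have
    mass at most [x ^- n] by tilting. *)
Lemma mass_succ_le (j : nat) : (0 < j)%N ->
  exists2 x : R, 1 < x &
    forall n, mass n.+1 <= (1 + j%:R^-1) * mass n + 4 * (x ^+ n)^-1.
Proof.
move=> j0; have [z z1 ztilt] := @exists_tilt R j.
(* On a bad tree [phi ^+ occ s t * theta ^+ occ s' t] is [z] to the power
   [j * occ s t - j.+1 * occ s' t >= 0], hence at least 1, while [phi + theta < 2] leaves room for
   some [x > 1]. *)
pose phi := z ^+ j; pose theta := (z ^+ j.+1)^-1.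
have ws' : 0 < w s' by rewrite weight_bistar mulr_gt0// exprn_gt0.
pose x := 1 + (2 - phi - theta) * w s'.
have x1 : 1 < x by rewrite ltrDl mulr_gt0// /phi /theta; lra.
exists x => // n.
have phi1 : 1 <= phi by rewrite exprn_ege1// ltW.
have z0 : 0 < z by lra.
have theta0 : 0 <= theta by rewrite invr_ge0 exprn_ge0// ltW.
have theta1 : theta <= 1 by rewrite invf_le1 ?exprn_gt0// exprn_ege1// ltW.
have := psum_tilt_le1 phi1 theta0 theta1 (ltW x1).
have -> : x - 1 = (2 - phi - theta) * w s' by rewrite /x addrC addKr.
move=> /(_ (lexx _)) tilt1.
pose bad t := (j.+1 * occ s' t <= j * occ s t)%N.
pose B m t := w t * (nprot t == m)%:R * (bad t)%:R.
have B0 m t : 0 <= B m t by rewrite !mulr_ge0.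
have Bx m : (psum (B m) <= ((x ^+ m)^-1)%:E)%E.
  have xm : 0 < x ^+ m by rewrite exprn_gt0//; lra.
  have [|V VE /andP[V0 _]] := @psum_fin R _ (B m) 1 (B0 m).
    rewrite -psum_weight; apply: le_psum => t.
    by rewrite /B -mulrA -natrM mulnb ler_piMr// lern1 leq_b1.
  rewrite VE lee_fin -(ler_pM2l xm) mulfV ?gt_eqF// -lee_fin EFinM -VE.
  rewrite -(psumZ _ (ltW xm)); apply: (le_trans _ tilt1); apply: le_psum => t.
  rewrite /B /tilt; case: eqP => [<-|_]; last first.
    by rewrite !(mulr0, mul0r) !mulr_ge0// exprn_ge0//; lra.
  rewrite mulr1 mulrCA; apply: ler_wpM2l => //; rewrite -mulrA.
  apply: ler_wpM2l; first by rewrite exprn_ge0//; lra.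
  case bt: (bad t); last by rewrite !mulr_ge0// exprn_ge0//; lra.
  rewrite /phi /theta exprVn -!exprM ler_pdivlMr ?exprn_gt0// mul1r.
  by rewrite ler_eXn2l.
have jj : (0 : R) < j%:R by rewrite ltr0n.
have j1 : (1 : R) <= j%:R by rewrite ler1n.
pose r : R := (2 * j%:R + 1) / j%:R.
have r0 : 0 <= r by rewrite divr_ge0//; lra.
have up : (psum (fun t => w t * (nprot t == n.+1)%:R)%R <=
    r%:E * psum (fun t => (occ s' t)%:R * occ_share n.+1 t)%R + psum (B n.+1))%E.
  rewrite -psumZ// -psumD//; last by move=> t; rewrite !mulr_ge0.
  apply: le_psum => t; rewrite /B /occ_share; set W := w t * _.
  have W0 : 0 <= W by rewrite mulr_ge0.
  case bt: (bad t); first by rewrite mulr1 lerDr !mulr_ge0.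
  move: bt; rewrite /bad mulr0 addr0; set a := occ s t; set b := occ s' t.
  move/negbT; rewrite -ltnNge => ab.
  rewrite natrD; apply: share_ge => //; last first.
    by rewrite natr1 -!natrM ler_nat ltnW.
  rewrite -natrD ltr0n addn_gt0 orbC; move: ab; case: (b) => // ab.
  by rewrite muln0 in ab.
have down : (r%:E * psum (fun t => (occ s t)%:R * occ_share n t)%R <=
    (1 + j%:R^-1)%:E * psum (fun t => w t * (nprot t == n)%:R)%R +
    3%:E * psum (B n))%E.
  have i0 : 0 <= 1 + j%:R^-1 :> R by rewrite addr_ge0.
  rewrite -!psumZ// -psumD//; try by move=> t; rewrite !mulr_ge0.
  apply: le_psum => t; rewrite /B /occ_share; set W := w t * _.
  have W0 : 0 <= W by rewrite mulr_ge0.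
  set a := occ s t; set b := occ s' t.
  have [/eqP|ab0] := posnP (a + b).
    rewrite addn_eq0 => /andP[/eqP -> _]; rewrite mul0r mulr0.
    by rewrite addr_ge0// !mulr_ge0.
  have {}ab0 : (0 : R) < (a + b)%:R by rewrite ltr0n.
  rewrite natrD in ab0 *.
  have jW : 0 <= (1 + j%:R^-1) * W by rewrite mulr_ge0.
  case bt: (bad t).
    rewrite mulr1; apply: (@le_trans _ _ (3 * W)); last by rewrite lerDr.
    exact: share_le3.
  rewrite mulr0 mulr0 addr0; apply: share_le => //.
  move: bt; rewrite /bad -/a -/b => /negbT; rewrite -ltnNge => ab.
  by rewrite natr1 -!natrM ler_nat ltnW.
rewrite -lee_fin -massE; apply: (le_trans up); rewrite psum_swap.
apply: (le_trans (leeD down (Bx _))); rewrite massE.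
(* The constant 4 collects 3 from the bad trees with [n] protected nodes and 1 from those with
   [n.+1]. *)
apply: (@le_trans _ _ (((1 + j%:R^-1) * mass n)%:E + 3%:E * ((x ^+ n)^-1)%:E +
   ((x ^+ n)^-1)%:E)%E); last first.
  by rewrite -EFinM -!EFinD lee_fin; lra.
apply: leeD; last first.
  rewrite lee_fin lef_pV2 ?posrE ?exprn_gt0//; try lra.
  by apply: ler_weXn2l => //; exact: ltW.
by rewrite -EFinM leeD2l// lee_wpmul2l// lee_fin.
Qed.

(* Trees reduced to a leaf are excluded, so that grafting creates a protected root. *)
Definition inner_mass (n : nat) : R :=
  fine (psum (fun t => w t * ((t != fleaf) && (nprot t == n))%:R)).

Lemma inner_massE n :
  psum (fun t => w t * ((t != fleaf) && (nprot t == n))%:R) = (inner_mass n)%:E.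
Proof. by rewrite fineK// psum_restrict_fin. Qed.

Lemma inner_mass_le n : inner_mass n <= mass n.
Proof.
rewrite -lee_fin -inner_massE -massE; apply: le_psum => t.
by apply: ler_wpM2l => //; case: (t != fleaf).
Qed.

Lemma mass_le_inner n : mass n <= inner_mass n + p 0 * (n == 0%N)%:R.
Proof.
rewrite -lee_fin -massE EFinD -inner_massE.
have p0n : 0 <= p 0 * (n == 0%N)%:R by rewrite mulr_ge0.
rewrite -(psum_delta fleaf p0n) -psumD; try by move=> t; rewrite mulr_ge0.
apply: le_psum => t; have [->|_] := eqVneq t fleaf.
  by rewrite mulr0 add0r mulr1 weight_leaf eq_sym.
by rewrite mulr0 addr0.
Qed.

(** * Grafting, growth and ratios of the masses *)

Definition graft_weight : R := p k * w (star k) ^+ k.-2.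

Lemma graft_weight_gt0 : 0 < graft_weight.
Proof. by rewrite mulr_gt0// exprn_gt0// weight_star mulr_gt0// exprn_gt0. Qed.

(** Two trees are joined under a new root completed by [k.-2] stars. None of its children is a leaf,
    so the root is protected, whereas the stars bring no protected node; [graft_weight] is the
    weight of what is added. *)
Lemma inner_mass_supermul n m :
  graft_weight * (inner_mass n * inner_mass m) <= inner_mass (n + m).+1.
Proof.
have kw : 0 <= graft_weight by rewrite ltW// graft_weight_gt0.
rewrite -lee_fin -inner_massE !EFinM -!inner_massE.
rewrite -psum_prod; try by move=> t; rewrite mulr_ge0.
rewrite -psumZ//.
apply: (@psum_inj_le _ _ _
  (fun z => [&& (z.1 != fleaf) && (nprot z.1 == n) & (z.2 != fleaf) && (nprot z.2 == m)])
  (fun z => Node (z.1 :: z.2 :: nseq k.-2 (star k)))).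
- by move=> t; rewrite mulr_ge0.
- by move=> [a b] [c d] _ _ /Node_inj[-> ->].
- move=> [a b] /andP[/andP[aN /eqP an] /andP[bN /eqP bm]].
  rewrite -[(a, b).1]/a -[(a, b).2]/b in aN an bN bm *.
  rewrite aN bN an bm !eqxx !mulr1.
  set t := Node _; have tN : t != fleaf by apply/eqP => /Node_inj.
  rewrite tN; have -> : nprot t = (n + m).+1.
    rewrite nprotE !big_cons big_nseq nprot_star// iter_addn mul0n an bm.
    rewrite !inE mem_nseq !(eq_sym fleaf) (negbTE aN) (negbTE bN).
    by rewrite (negbTE (star_neq_leaf _))// andbF /= !addn0 add1n.
  rewrite eqxx mulr1 /t weightE !big_cons big_nseq iter_mulr mulr1.
  rewrite [size _]/= size_nseq (_ : k.-2.+2 = k); last by lia.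
  by rewrite /graft_weight le_eqVlt; apply/orP; left; apply/eqP; ring.
- move=> [a b]; rewrite negb_and => /orP[] /negbTE /= ->.
    by rewrite mulr0 mul0r mulr0.
  by rewrite !mulr0.
Qed.

Lemma inner_mass_gt0 n : 0 < inner_mass n.
Proof.
have base : 0 < inner_mass 0.
  rewrite -lte_fin -inner_massE.
  have f0 t : 0 <= w t * ((t != fleaf) && (nprot t == 0%N))%:R by rewrite mulr_ge0.
  apply: lt_le_trans (term_le_psum (star k) f0).
  rewrite lte_fin star_neq_leaf// nprot_star// mulr1.
  by rewrite weight_star mulr_gt0// exprn_gt0.
elim: n => // n IH.
apply: lt_le_trans (_ : graft_weight * (inner_mass n * inner_mass 0) <= _).
  by apply: mulr_gt0; [exact: graft_weight_gt0|exact: mulr_gt0].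
by have := inner_mass_supermul n 0; rewrite addn0.
Qed.

Lemma mass_gt0 n : 0 < mass n.
Proof. exact: lt_le_trans (inner_mass_gt0 n) (inner_mass_le n). Qed.

(* Criticality enters here: a finite value [V] of the series would satisfy
   [V >= g V + (x - 1) * w s'] with [g V >= V], [g] being the generating function of [p]. *)
Lemma psum_nprot_infinite (x : R) : 1 < x -> psum (fun t => w t * x ^+ nprot t) = +oo%E.
Proof.
move=> x1; have x0 : 0 < x by lra.
have v0 t : 0 <= w t * x ^+ nprot t by rewrite mulr_ge0// exprn_ge0// ltW.
have := psum_ge0 v0; case VE : (psum _) => [V| |]//; rewrite lee_fin => V0.
have ws' : 0 < w s' by rewrite weight_bistar mulr_gt0// exprn_gt0.
have c0 : 0 <= (x - 1) * w s' by rewrite mulr_ge0//; lra.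
have F0 l : 0 <= p (size l) * \prod_(t <- l) (w t * x ^+ nprot t).
  by rewrite mulr_ge0// prodr_ge0.
(* The root contributes a factor 1 or [x]; at [bistar] it is protected, which gains
   [(x - 1) * w s']. *)
have : (psum (fun l => p (size l) * \prod_(t <- l) (w t * x ^+ nprot t) +
   (x - 1) * w s' * (l == kids s')%:R)%R <= V%:E)%E.
  rewrite -VE psum_ftree; apply: le_psum => l.
  have [->|_] := eqVneq l (kids s').
    rewrite big_nseq nprot_star// expr0 mulr1 iter_mulr mulr1 mulr1.
    rewrite -[Node (kids _)]/s' nprot_bistar// expr1 size_nseq.
    have -> : p k * w (star k) ^+ k = w s'.
      by rewrite [RHS]weightE size_nseq big_nseq iter_mulr mulr1.
    lra.
  rewrite mulr0 addr0 nprotE exprD weightE -mulrA; apply: ler_wpM2l => //.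
  rewrite big_split/= expr_sum; apply: ler_wpM2l; first exact: prodr_ge0.
  rewrite ler_peMl//; first by apply: prodr_ge0 => t _; rewrite exprn_ge0// ltW.
  by rewrite exprn_ege1// ltW.
rewrite psumD//; last by move=> l; rewrite mulr_ge0.
rewrite (psum_branching v0 VE) psum_delta//.
have := offspring_gf_ge V0; case: (psum _) => [g| |]//.
rewrite lee_fin => h1; rewrite -EFinD lee_fin => h2; exfalso.
have := sqr_ge0 (1 - V); have : 0 < (x - 1) * w s' by rewrite mulr_gt0//; lra.
have := mulr_ge0 (p_ge0 k) (sqr_ge0 (1 - V)); lra.
Qed.

(** Otherwise, for [x] between 1 and [y], the series of the [mass n * x ^+ n] would be dominated,
    apart from the leaf, by a geometric series of ratio [x / y], against [psum_nprot_infinite]. *)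
Lemma inner_mass_unbounded (y M : R) : 1 < y -> 0 < M ->
  exists n, M < inner_mass n * y ^+ n.
Proof.
move=> y1 M0; apply/not_existsP => hM.
have [x x1 xy'] : exists2 x, 1 < x & x < y by exists ((1 + y) / 2); lra.
have xy : x / y < 1 by rewrite ltr_pdivrMr; lra.
have z0 : 0 <= x / y by rewrite divr_ge0//; lra.
have f0 t : 0 <= w t * x ^+ nprot t by rewrite mulr_ge0// exprn_ge0//; lra.
have := psum_nprot_infinite x1; rewrite (psum_fiber nprot)//.
rewrite (@eq_esum _ _ _ _ (fun n => (mass n * x ^+ n)%:E)); last first.
  move=> n _; rewrite mulrC EFinM -massE -psumZ; last by rewrite exprn_ge0//; lra.
  apply: eq_psum => t; rewrite [n == _]eq_sym.
  by case: eqP => [->|_]; rewrite ?mulr0// !mulr1 mulrC.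
rewrite -/(psum (fun n => mass n * x ^+ n)) => oo.
have : (psum (fun n => mass n * x ^+ n)%R <=
  psum (fun n => p 0 * (n == 0%N)%:R + M * (x / y) ^+ n)%R)%E.
  apply: le_psum => n; have xn : 0 <= x ^+ n by rewrite exprn_ge0//; lra.
  apply: le_trans (ler_wpM2r xn (mass_le_inner n)) _.
  rewrite mulrDl addrC; apply: lerD.
    by case: eqP => [->|_]; rewrite ?mulr0 ?mul0r// expr0 !mulr1.
  rewrite exprMn mulrA mulrAC; apply: ler_wpM2r => //.
  have := hM n; move/negP; rewrite -leNgt exprVn ler_pdivlMr// exprn_gt0//; lra.
have r01 : 0 <= x / y < 1 by apply/andP.
have M0' := ltW M0.
rewrite oo psumD; last 2 first.
- by move=> n; rewrite mulr_ge0.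
- by move=> n; rewrite mulr_ge0// exprn_ge0.
by rewrite psum_delta// psumZ// psum_geometric.
Qed.

(** Once [graft_weight * inner_mass m * y ^+ m.+1 >= 1], passing from [n] to [n + m.+1] does not
    decrease [inner_mass n * y ^+ n]. Steps of length [m.+1] lead down to finitely many values, all
    positive. *)
Lemma mass_subexp (y : R) : 1 < y -> exists2 c, 0 < c & forall n, c <= mass n * y ^+ n.
Proof.
move=> y1; have y0 : 0 < y by lra.
have ky : 0 < (graft_weight * y)^-1 by rewrite invr_gt0 mulr_gt0// graft_weight_gt0.
have [m hm] := inner_mass_unbounded y1 ky.
have {}hm : 1 <= graft_weight * inner_mass m * y ^+ m.+1.
  move: hm; rewrite -[ltLHS]div1r ltr_pdivrMr; last by rewrite mulr_gt0// graft_weight_gt0.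
  by move=> /ltW; rewrite exprS; congr (_ <= _); ring.
have [|c c0 cu] := @pos_lower_bound R (fun n => inner_mass n * y ^+ n) m.+1.
  by move=> n; rewrite mulr_gt0// ?exprn_gt0// inner_mass_gt0.
exists c => // n; apply: (@le_trans _ _ (inner_mass n * y ^+ n)); last first.
  by apply: ler_wpM2r (inner_mass_le _); rewrite exprn_ge0// ltW.
elim/ltn_ind: n => n IH; have [/cu//|mn] := ltnP n m.+1.
have nE : n = ((n - m.+1) + m).+1 by lia.
apply: le_trans (IH (n - m.+1)%N _) _; first by lia.
have := inner_mass_supermul (n - m.+1) m; rewrite -nE => sup.
apply: le_trans (ler_wpM2r (ltW (exprn_gt0 n y0)) sup).
have -> : y ^+ n = y ^+ (n - m.+1) * y ^+ m.+1 by rewrite -exprD subnK.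
have := inner_mass_gt0 (n - m.+1); have := exprn_gt0 (n - m.+1) y0.
set Y := y ^+ (n - m.+1); set I := inner_mass (n - _) => Y0 I0.
rewrite (_ : _ * (Y * _) = (I * Y) * (graft_weight * inner_mass m * y ^+ m.+1)); last by ring.
by rewrite ler_peMr// mulr_ge0// ltW.
Qed.

Lemma mass_ratio (eps : R) : 0 < eps ->
  exists N, forall n, (N <= n)%N -> mass n.+1 <= (1 + eps) * mass n.
Proof.
(* Half of [eps] covers the factor [1 + j%:R^-1], the other half the error term, compared with
   [mass n >= c * y ^- n] for some [y < x]. *)
move=> eps0; pose j := (Num.truncn (2 / eps)).+1.
have jj : (0 : R) < j%:R by rewrite ltr0n.
have je : 2 * j%:R^-1 <= eps.
  rewrite ler_pdivrMr// mulrC -ler_pdivrMr// ltW//.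
  by apply: truncnS_gt.
have [x x1 hx] := mass_succ_le (ltn0Sn _ : (0 < j)%N).
have [y y1 xy'] : exists2 y, 1 < y & y < x by exists ((1 + x) / 2); lra.
have x0 : 0 < x by lra.
have xy : y / x < 1 by rewrite ltr_pdivrMr; lra.
have z0 : 0 <= y / x by rewrite divr_ge0//; lra.
have [c c0 hc] := mass_subexp y1.
have : (y / x) ^+ n @[n --> \oo] --> (0 : R) by apply: cvg_expr; rewrite ger0_norm.
have cj : 0 < c / (4 * j%:R) by rewrite divr_gt0// mulr_gt0.
move=> /cvgrPdist_le /(_ _ cj)[N _ hN]; exists N => n Nn.
apply: le_trans (hx n) _; have := hN n Nn; rewrite /= sub0r normrN ger0_norm ?exprn_ge0//.
rewrite ler_pdivlMr; last by rewrite mulr_gt0.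
move=> h; have xn := exprn_gt0 n x0.
have : 4 * (x ^+ n)^-1 <= j%:R^-1 * mass n.
  have yn := exprn_gt0 n (lt_trans ltr01 y1).
  move: h; rewrite exprMn exprVn mulrAC ler_pdivrMr// => h.
  rewrite ler_pdivrMr// -mulrA ler_pdivlMl// -(ler_pM2l yn) [j%:R * 4]mulrC.
  apply: le_trans h _; rewrite mulrA; apply: ler_wpM2r; first exact: ltW.
  by rewrite mulrC.
have := mass_gt0 n; nra.
Qed.

(** The ratio bound is iterated [m] times, and [1 - eps <= (1 + eps)^-1]. *)
Lemma mass_shift (m : nat) (eps : R) : 0 < eps ->
  exists N, forall n, (N <= n)%N -> (1 - eps) * mass n <= mass (n - m).
Proof.
move=> eps0.
have [N hN] : exists N, forall n, (N <= n)%N -> mass (n + m) <= (1 + eps) * mass n.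
  elim: m eps eps0 => [|m IH] eps eps0.
    exists 0%N => n _; rewrite addn0; have := mass_gt0 n; nra.
  (* This choice gives [(1 + e) ^+ 2 <= 1 + eps]. *)
  pose e := Num.min eps 1 / 3.
  have e0 : 0 < e by rewrite divr_gt0// lt_min eps0 ltr01.
  have [N hN] := IH _ e0; have [N' hN'] := mass_ratio e0.
  exists (maxn N N') => n; rewrite geq_max => /andP[nN nN'].
  rewrite addnS; apply: le_trans (hN' _ _) _; first by rewrite (leq_trans nN')// leq_addr.
  apply: le_trans (ler_wpM2l _ (hN _ nN)) _; first by lra.
  have e1 : e <= 1 / 3 by rewrite ler_pM2r// ge_min lexx orbT.
  have e2 : e <= eps / 3 by rewrite ler_pM2r// ge_min lexx.
  rewrite mulrA; apply: ler_wpM2r; first by rewrite ltW// mass_gt0.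
  nra.
exists (N + m)%N => n nN; have /hN : (N <= n - m)%N by lia.
rewrite subnK; last by lia.
have := mass_gt0 n; have := mass_gt0 (n - m); nra.
Qed.

(** * Decomposition of balls by contexts *)

Let wc_ge0 c : 0 <= weight_ctx p c. Proof. exact: weight_ctx_ge0. Qed.

(** Product of [p] at the numbers of children over the vertices of height less than [h]: the
    Galton-Watson probability of agreeing with [t] up to height [h]. *)
Fixpoint trunc_weight (h : nat) (t : ftree) : R :=
  if h is h'.+1 then p (size (kids t)) * \prod_(u <- kids t) trunc_weight h' u
  else 1.

Lemma trunc_weight_ge0 h t : 0 <= trunc_weight h t.
Proof. by elim: h t => // h IH t; rewrite mulr_ge0// prodr_ge0. Qed.

Lemma trunc_weight_full h t : (height t < h)%N -> trunc_weight h t = w t.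
Proof.
elim: h t => // h IH [l]; rewrite height_lt weightE /= => /allP hl.
by congr (_ * _); rewrite !big_seq; apply: eq_bigr => t /hl /IH.
Qed.

Lemma psum_all2 (r : ftree -> ftree -> bool) (V : ftree -> R) (L : seq ftree) :
  (forall t, psum (fun u => w u * (r t u)%:R) = (V t)%:E) ->
  psum (fun l => (\prod_(u <- l) w u) * (all2 r L l)%:R) = (\prod_(t <- L) V t)%:E.
Proof.
move=> rV; have pw (l : seq ftree) : 0 <= \prod_(u <- l) w u by apply: prodr_ge0.
elim: L => [|t L IH]; rewrite psum_seq; try by move=> l; apply: mulr_ge0.
  rewrite !big_nil mulr1 -[RHS]adde0; congr (_ + _)%E.
  by rewrite -[RHS](psum0 (ftree * seq ftree)%type); apply: eq_psum => z /=; rewrite mulr0.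
rewrite mulr0 add0e big_cons EFinM -IH -rV -psum_prod.
- by apply: eq_psum => -[u l] /=; rewrite big_cons -mulnb natrM mulrACA.
- by move=> u; rewrite mulr_ge0.
- by move=> u; rewrite mulr_ge0.
Qed.

Lemma psum_agree h t :
  psum (fun u => w u * (agree h t u)%:R) = (trunc_weight h t)%:E.
Proof.
elim: h t => [|h IH] t /=.
  by rewrite -psum_weight; apply: eq_psum => u; rewrite mulr1.
rewrite psum_ftree EFinM -(psum_all2 _ IH) -psumZ//.
apply: eq_psum => l; rewrite [kids _]/= weightE.
case e: (all2 _ _ _); last by rewrite !mulr0.
by rewrite (all2_size e) mulrA.
Qed.

(** Side branches vary independently with total mass one, apart from the agreement imposed. So every
    vertex of height less than [size x] contributes its factor of [trunc_weight] once, whatever the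
    position [x] of the hole. *)
Lemma psum_fits x t : fmem t x ->
  psum (fun c => weight_ctx p c * (fits x t c)%:R) = (trunc_weight (size x) t)%:E.
Proof.
elim: x t => [|i x IH] t.
  move=> _; rewrite psum_seq; last by move=> c; rewrite mulr_ge0.
  rewrite /weight_ctx big_nil mulr1 -[RHS]adde0; congr (_ + _)%E.
  rewrite -[RHS](psum0 ((seq ftree * seq ftree) * fctx)%type).
  by apply: eq_psum => z /=; rewrite mulr0.
move=> /= /andP[it /IH {}IH].
rewrite psum_seq; last by move=> c; rewrite mulr_ge0.
rewrite mulr0 add0e.
have -> : p (size (kids t)) * \prod_(u <- kids t) trunc_weight (size x) u =
  p (size (kids t)) * (\prod_(u <- take i.-1 (kids t)) trunc_weight (size x) u *
    \prod_(u <- drop i (kids t)) trunc_weight (size x) u) *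
    trunc_weight (size x) (nth fleaf (kids t) i.-1).
  by rewrite {2}(kids_split it) big_cat big_cons /=; ring.
have pw (l : seq ftree) : 0 <= \prod_(u <- l) w u by apply: prodr_ge0.
rewrite EFinM -IH EFinM EFinM -!(psum_all2 _ (psum_agree _)).
rewrite -psum_prod; try by move=> l; rewrite mulr_ge0.
rewrite -psumZ// -psum_prod; last 2 first.
- by move=> z; rewrite !mulr_ge0.
- by move=> z; rewrite mulr_ge0.
apply: eq_psum => -[[l1 l2] c] /=.
rewrite /weight_ctx big_cons /weight_frame it /=.
case e1: (all2 _ _ l1); last by rewrite !(mulr0, mul0r).
case e2: (all2 _ _ l2); last by rewrite !(mulr0, mul0r).
rewrite /= !mulr1 -(all2_size e1) -(all2_size e2).
rewrite [X in _ = p X * _ * _](_ : _ = (size (take i.-1 (kids t)) + size (drop i (kids t))).+1).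
  by rewrite !mulrA.
by rewrite {1}(kids_split it) size_cat /= addnS.
Qed.

Definition ball_mass (h : nat) (t : ftree) (n : nat) : R :=
  fine (psum (fun u => w u * (agree h t u && (nprot u == n))%:R)).

Lemma ball_massE h t n :
  psum (fun u => w u * (agree h t u && (nprot u == n))%:R) = (ball_mass h t n)%:E.
Proof. by rewrite fineK// psum_restrict_fin. Qed.

(** For such [n] the plugged tree has more protected nodes than every context of [r], so [plug_inj]
    makes plugging injective and the contributions of the contexts add up. *)
Lemma sum_ctx_le_ball_mass h t n (r : seq fctx) (D : pred fctx) :
  (forall c, D c -> exists x, [/\ size x = h & fits x t c]) ->
  uniq r -> {in r, forall c, (nprot_ctx c + \max_(d <- r) nprot_ctx d < n)%N} ->
  \sum_(c <- r) weight_ctx p c * (D c)%:R * mass (n - nprot_ctx c) <=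
  ball_mass h t n.
Proof.
move=> Dfits ur nbig.
have m0 m : 0 <= mass m by exact: mass_ge0.
pose F c := weight_ctx p c * ((c \in r) && D c)%:R * mass (n - nprot_ctx c).
have F0 c : 0 <= F c by rewrite !mulr_ge0.
rewrite -lee_fin -ball_massE.
have -> : \sum_(c <- r) weight_ctx p c * (D c)%:R * mass (n - nprot_ctx c) =
    \sum_(c <- r) F c.
  by rewrite !big_seq; apply: eq_bigr => c cr; rewrite /F cr.
apply: le_trans (sum_le_psum F0 ur) _.
pose f (z : fctx * ftree) := weight_ctx p z.1 * ((z.1 \in r) && D z.1)%:R *
  (w z.2 * (nprot z.2 == n - nprot_ctx z.1)%N%:R).
have -> : psum F = psum f.
  rewrite psum_pair; last by move=> z; rewrite !mulr_ge0.
  apply: eq_esum => c _; rewrite /f /F EFinM -massE -psumZ//.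
  by rewrite mulr_ge0.
apply: (@psum_inj_le _ _ _
  (fun z => [&& z.1 \in r, D z.1 & nprot z.2 == (n - nprot_ctx z.1)%N])
  (fun z => plug z.1 z.2)).
- by move=> u; rewrite mulr_ge0.
- move=> [c u] [c' u']; rewrite -!topredE /= => /and3P[cr /Dfits[x [xh fx]] /eqP cu].
  move=> /and3P[cr' /Dfits[x' [xh' fx']] /eqP cu'] e.
  have ltm : (nprot_ctx c < nprot u')%N.
    have : (nprot_ctx c <= \max_(d <- r) nprot_ctx d)%N.
      by rewrite (big_rem c)//= leq_maxl.
    by have := nbig _ cr'; rewrite cu'; lia.
  have [||-> ->//] := plug_inj _ _ ltm e.
    by apply: nprot_gt0_neq_leaf; apply: leq_ltn_trans ltm.
  by rewrite (fits_size fx) (fits_size fx') xh.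
- move=> [c u] /and3P[/= cr Dc /eqP cu].
  have [x [xh fx]] := Dfits _ Dc.
  rewrite /f /= cr Dc cu eqxx !mulr1 -xh fits_agree// weight_plug nprot_plug.
    rewrite cu subnKC ?eqxx ?mulr1//.
    by have := nbig _ cr; lia.
  by apply: nprot_gt0_neq_leaf; rewrite cu; have := nbig _ cr; lia.
- move=> [c u] /=; rewrite /f /= !negb_and => /or3P[] /negbTE ->.
  + by rewrite mulr0 mul0r.
  + by rewrite andbF mulr0 mul0r.
  + by rewrite !mulr0.
Qed.

(** The contexts with their hole in [X] have total weight [S]; finitely many of them carry all but
    [eps / 2], and for these [mass_shift] compares [mass (n - nprot_ctx c)] with [mass n]. *)
Lemma ball_mass_lower h t (X : seq (seq nat)) (eps : R) : uniq X ->
  {in X, forall x, size x = h /\ fmem t x} -> 0 < eps ->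
  exists N, forall n, (N <= n)%N ->
    ((size X)%:R * trunc_weight h t - eps) * mass n <= ball_mass h t n.
Proof.
move=> uX hX eps0; pose S := (size X)%:R * trunc_weight h t.
have S0 : 0 <= S by rewrite mulr_ge0// trunc_weight_ge0.
pose D c := has (fun x => fits x t c) X.
(* By [fits_inj] a context has its hole at no more than one vertex of [X]. *)
have sumD c : \sum_(x <- X) (fits x t c)%:R = (D c)%:R :> R.
  rewrite /D; case: (boolP (has _ _)) => [/hasP[x xX fx]|/hasPn nf]; last first.
    by rewrite big_seq big1// => x /nf /negbTE ->.
  rewrite (bigD1_seq x)//= fx big1 ?addr0// => y yx.
  by case: (boolP (fits y t c)) => // /(fits_inj fx) e; rewrite e eqxx in yx.
pose g c := weight_ctx p c * (D c)%:R.
have g0 c : 0 <= g c by rewrite mulr_ge0.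
have gS : psum g = S%:E.
  rewrite (@eq_psum _ _ _ (fun c => \sum_(x <- X) weight_ctx p c * (fits x t c)%:R)).
    rewrite psum_sum; last by move=> x c; rewrite mulr_ge0.
    rewrite (eq_big_seq (fun=> (trunc_weight h t)%:E)); last first.
      by move=> x /hX[<- fx]; exact: psum_fits.
    by rewrite sumEFin big_const_seq count_predT iter_addr_0 /S mulr_natl.
  by move=> c; rewrite /g -sumD mulr_sumr.
have [r ur rS] : exists2 r, uniq r & ((S - eps / 2)%:E < (\sum_(c <- r) g c)%:E)%E.
  by apply: psum_gt; rewrite gS lte_fin; lra.
rewrite lte_fin in rS; set G := \sum_(c <- r) g c in rS.
have GS : G <= S by rewrite -lee_fin -gS; exact: sum_le_psum.
(* Chosen so that [del * G <= eps / 2]; the added 1 covers the case [S = 0]. *)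
pose del := eps / (2 * (S + 1)).
have del0 : 0 < del by rewrite divr_gt0//; lra.
have delS : del * S <= eps / 2.
  by rewrite /del mulrAC ler_pdivrMr; [nra|lra].
have [N1 hN1] := eventually_all r (fun c => mass_shift (nprot_ctx c) del0).
pose M := (\max_(d <- r) nprot_ctx d)%N.
exists (maxn N1 (M + M).+1) => n; rewrite geq_max => /andP[nN1 nM].
have m0 : 0 <= mass n by exact: mass_ge0.
apply: le_trans (_ : (1 - del) * G * mass n <= _).
  by apply: ler_wpM2r => //; rewrite -/S; nra.
apply: le_trans (@sum_ctx_le_ball_mass h t n r D _ ur _).
- rewrite mulrAC mulrC /G mulr_suml big_seq [leRHS]big_seq; apply: ler_sum => c cr.
  by apply: ler_wpM2l => //; exact: hN1.
- by move=> c /hasP[x /hX[xh _] fx]; exists x.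
- move=> c cr; apply: leq_ltn_trans nM; rewrite -/M leq_add2r.
  by rewrite /M (big_rem c)//= leq_maxl.
Qed.

End critical.

(** * Trees as sets of words *)

Fixpoint subtree (t : ftree) (u : seq nat) : ftree :=
  if u is i :: u' then subtree (nth fleaf (kids t) i.-1) u' else t.

Lemma fmem_rcons t u i :
  fmem t (rcons u i) = fmem t u && (0 < i <= size (kids (subtree t u)))%N.
Proof. by elim: u t => [|j u IH] t /=; rewrite ?andbT// IH andbA. Qed.

Lemma fmem_cat t u s : fmem t (u ++ s) -> fmem t u.
Proof. by elim: u t => [|j u IH] t //= /andP[-> /IH ->]. Qed.

Lemma is_tree_fmem t : is_tree (fmem t).
Proof.
split=> // [u _ /prefixP[s ->] /fmem_cat//|u tu].
by exists (size (kids (subtree t u))) => i; rewrite fmem_rcons tu.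
Qed.

Definition embed (t : ftree) : tree := Tree (is_tree_fmem t).

Lemma tree_eqP (t t' : tree) : (forall u, t u <-> t' u) -> t = t'.
Proof.
case: t t' => [t Pt] [t' Pt'] /= tt'; have e : t = t'.
  by apply/funext => u; apply/propext.
by move: Pt; rewrite e => Pt; congr Tree; exact: Prop_irrelevance.
Qed.

Lemma tree_prefix (t : tree) u s : t (u ++ s) -> t u.
Proof.
by case: (treeP t) => _ + _; apply; rewrite prefix_prefix.
Qed.

Lemma nchild_mem (t : tree) u (n : nat) : t u ->
  (forall i, t (rcons u i) <-> (1 <= i <= n)%N) -> nchild t u = n%:Z.
Proof.
move=> tu tn; rewrite /nchild asboolT//; congr Posz.
apply: xget_unique => // m tm.
have {}tm i : (1 <= i <= m)%N <-> (1 <= i <= n)%N by rewrite -tm.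
have [h1 h2] : (m <= n)%N /\ (n <= m)%N.
  split; case: (posnP m) (posnP n) => [m0|m0] [n0|n0]; rewrite ?m0 ?n0//.
  - by have := (tm m).1; rewrite m0 leqnn n0 => /(_ isT) /andP[].
  - by have := (tm m).1; rewrite m0 leqnn => /(_ isT) /andP[].
  - by have := (tm n).2; rewrite n0 leqnn m0 => /(_ isT) /andP[].
  - by have := (tm n).2; rewrite n0 leqnn => /(_ isT) /andP[].
by apply/eqP; rewrite eqn_leq h1.
Qed.

Lemma nchildP (t : tree) u : t u ->
  exists2 n : nat, nchild t u = n%:Z & forall i, t (rcons u i) <-> (1 <= i <= n)%N.
Proof.
move=> tu; case: (treeP t) => _ _ /(_ u tu)[n tn]; exists n => //.
exact: nchild_mem.
Qed.

Lemma nchild_notin (t : tree) u : ~ t u -> nchild t u = -1.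
Proof. by move=> tu; rewrite /nchild asboolF. Qed.

Lemma nchild_ge0 (t : tree) u : t u <-> 0 <= nchild t u.
Proof.
split=> [/nchildP[n -> _]//|].
by have [//|/nchild_notin ->] := pselect (t u).
Qed.

Lemma nchild_embed t u : fmem t u -> nchild (embed t) u = (size (kids (subtree t u)))%:Z.
Proof. by move=> tu; apply: nchild_mem => // i; rewrite /= fmem_rcons tu. Qed.

Lemma truncP h (t s : tree) :
  trunc h t = trunc h s <-> forall u, (size u <= h)%N -> (t u <-> s u).
Proof.
split=> [ts u uh|ts].
  split=> [tu|su].
    by have : trunc h t u by []; rewrite ts => -[].
  by have : trunc h s u by []; rewrite -ts => -[].
by apply/seteqP; split => u [/= tu uh]; split => //; apply/(ts _ uh).
Qed.

Lemma trunc_le h h' (t s : tree) : (h <= h')%N ->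
  trunc h' t = trunc h' s -> trunc h t = trunc h s.
Proof.
by move=> hh /truncP ts; apply/truncP => u uh; apply: ts; exact: leq_trans hh.
Qed.

Lemma trunc_nchild h (t s : tree) u : (size u < h)%N -> trunc h t = trunc h s ->
  nchild t u = nchild s u.
Proof.
move=> uh /truncP ts; have [su|nsu] := pselect (s u); last first.
  by rewrite !nchild_notin// => /(ts _ (ltnW uh)).
have [n -> sn] := nchildP su; apply: nchild_mem; first by apply/(ts _ (ltnW uh)).
by move=> i; rewrite -sn; apply: ts; rewrite size_rcons.
Qed.

(** Balls grow one generation at a time, in the form in which the laws of both random trees are
    prescribed. *)
Lemma trunc_succ h (t s : tree) : trunc h.+1 t = trunc h.+1 s <->
  trunc h t = trunc h s /\ (forall u, generation h s u -> nchild t u = nchild s u).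
Proof.
split=> [ts|[/truncP ts tn]].
  by split=> [|u [_ uh]]; [exact: trunc_le ts|apply: trunc_nchild ts; rewrite uh].
apply/truncP => u; rewrite leq_eqVlt => /predU1P[|]; last exact: ts.
case/lastP: u => // u i; rewrite size_rcons => -[uh].
have tsu : t u <-> s u by apply: ts; rewrite uh.
have key : s u -> (t (rcons u i) <-> s (rcons u i)).
  move=> su; have [n e sn] := nchildP su.
  have [m e' tm] := nchildP (tsu.2 su).
  have := tn u (conj su uh); rewrite e e' => -[mn].
  by rewrite tm sn mn.
split=> h1; have : s u.
- by apply/tsu; move: h1; rewrite -cats1 => /tree_prefix.
- by move/key => <-.
- by move: h1; rewrite -cats1 => /tree_prefix.
- by move/key => ->.
Qed.

(** The tree formed by [u] and its descendants over [h] generations, which indexes balls by a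
    countable type. It is meaningful only for [u] in [t]. *)
Fixpoint cut (h : nat) (t : tree) (u : seq nat) : ftree :=
  if h is h'.+1 then
    Node (mkseq (fun i => cut h' t (rcons u i.+1)) `|nchild t u|%N)
  else fleaf.

Lemma fmem_cut h (t : tree) u s : t u ->
  fmem (cut h t u) s <-> (size s <= h)%N /\ t (u ++ s).
Proof.
elim: h u s => [|h IH] u [|i s] tu /=.
- by rewrite cats0.
- by rewrite ltn0; split=> [|[]//]; case: i.
- by rewrite cats0.
have [n -> tn] := nchildP tu; rewrite absz_nat size_mkseq -cat_rcons ltnS.
split=> [/andP[i0]|[sh tis]].
  have ti : t (rcons u i) by rewrite tn.
  by case: i i0 ti => // i i0 ti; rewrite nth_mkseq// IH.
have ti : t (rcons u i) by apply: tree_prefix tis.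
have := ti; rewrite tn => i0; rewrite i0 /=.
by case: i i0 ti tis => // i i0 ti tis; rewrite nth_mkseq// IH.
Qed.

Lemma tree_root (t : tree) : t [::].
Proof. by case: (treeP t). Qed.

Lemma trunc_cut h (t : tree) : trunc h (embed (cut h t [::])) = trunc h t.
Proof.
apply/truncP => u uh; have := fmem_cut h u (tree_root t).
by rewrite cat0s => tu; split => [/tu[]//|hu]; apply/tu.
Qed.

Lemma cut_trunc h (t s : tree) : trunc h t = trunc h s -> cut h t [::] = cut h s [::].
Proof.
move=> ts; have : trunc (size ([::] : seq nat) + h) t = trunc (size ([::] : seq nat) + h) s.
  by rewrite add0n.
move: [::] => u; elim: h u {ts} => //= h IH u ts.
rewrite (trunc_nchild _ ts); last by rewrite -addSnnS leq_addr.
by congr Node; apply: eq_mkseq => i; apply: IH; rewrite size_rcons addSnnS.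
Qed.

Lemma cut_eq h (t s : tree) : cut h t [::] = cut h s [::] <-> trunc h t = trunc h s.
Proof.
split; last exact: cut_trunc.
by move=> e; rewrite -[LHS]trunc_cut e trunc_cut.
Qed.

Lemma fmem_height t u : fmem t u -> (size u <= height t)%N.
Proof.
elim: u t => // i u IH [l] /= /andP[/andP[i0 il] /IH h].
rewrite big_map -/height (big_nth fleaf) big_mkord.
have il' : (i.-1 < size l)%N by rewrite prednK.
by apply: leq_trans (leq_bigmax (Ordinal il')).
Qed.

(** One level beyond the height is needed to see that the deepest vertices of [f] have no
    children. *)
Lemma trunc_embed (t : tree) f :
  trunc (height f).+1 t = trunc (height f).+1 (embed f) <-> t = embed f.
Proof.
split=> [/truncP tf|-> //]; apply: tree_eqP => u.
have [uh|uh] := leqP (size u) (height f).+1; first exact: tf.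
have nf v : (height f < size v)%N -> ~ fmem f v.
  by move=> hv /fmem_height; rewrite leqNgt hv.
split=> [tu|/nf] //; last by case; exact: ltnW.
have : t (take (height f).+1 u).
  by apply: (@tree_prefix t _ (drop (height f).+1 u)); rewrite cat_take_drop.
have sz : size (take (height f).+1 u) = (height f).+1 by rewrite size_takel// ltnW.
by move/(tf _ _).1; rewrite sz => /(_ (leqnn _)) /nf; rewrite sz => /(_ (leqnn _)).
Qed.

Lemma embed_inj : injective embed.
Proof.
move=> f g; elim/ftree_ind': f g => l IH [l'] e.
have fmemE u : fmem (Node l) u = fmem (Node l') u.
  by have := congr1 (fun t : tree => t u) e => /= h; apply/idP/idP; rewrite h.
have sz : size l = size l'.
  have := nchild_embed (isT : fmem (Node l) [::]).
  by rewrite e nchild_embed//= => -[].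
congr Node; apply: (@eq_from_nth _ fleaf) => // i il.
apply: IH; first exact: mem_nth.
apply: tree_eqP => u /=; have := fmemE (i.+1 :: u).
by rewrite /= -sz il /= => ->.
Qed.

Lemma agree_trunc h f g : agree h f g -> trunc h (embed g) = trunc h (embed f).
Proof.
move=> fg; apply/truncP => u; elim: u h f g fg => // i u IH [//|h] f g /= fg.
rewrite ltnS => uh; rewrite (all2_size fg).
have [/andP[i0 ig]|_]//= := boolP (0 < i <= size (kids g))%N.
have {}ig : (i.-1 < size (kids g))%N by rewrite prednK.
apply: IH uh; elim: (kids f) (kids g) i.-1 ig fg => [|x s IH] [|y s'] [|j] //=.
  by move=> _ /andP[].
by move=> js /andP[_]; exact: IH.
Qed.

Fixpoint gens (h : nat) (t : ftree) : seq (seq nat) :=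
  if h is h'.+1 then
    flatten [seq [seq i.+1 :: u | u <- gens h' (nth fleaf (kids t) i)]
            | i <- index_iota 0 (size (kids t))]
  else [:: [::]].

Lemma mem_gens h t u : (u \in gens h t) = fmem t u && (size u == h).
Proof.
elim: h t u => [|h IH] t u /=.
  by rewrite inE; case: u => //= *; rewrite andbF.
apply/flatten_mapP/idP => [[i]|].
  rewrite mem_index_iota /= => il /mapP[v]; rewrite IH => /andP[tv /eqP vh] ->.
  by rewrite /= il tv vh eqxx.
case: u => // -[|i] u //= /andP[/andP[il tu] uh]; exists i.
  by rewrite mem_index_iota.
by apply/mapP; exists u => //; rewrite IH tu.
Qed.

Lemma uniq_flatten_cons (F : nat -> seq (seq nat)) r : uniq r ->
  (forall i, uniq (F i)) -> uniq (flatten [seq [seq i.+1 :: u | u <- F i] | i <- r]).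
Proof.
move=> + uF; elim: r => //= i r IH /andP[ir /IH ur]; rewrite cat_uniq ur andbT.
rewrite map_inj_uniq ?uF; last by move=> u v [].
apply/hasPn => _ /flatten_mapP[j jr /mapP[u _ ->]].
by apply/mapP => -[v _ [ij _]]; rewrite -ij jr in ir.
Qed.

Lemma uniq_gens h t : uniq (gens h t).
Proof.
elim: h t => // h IH t /=; apply: uniq_flatten_cons => //; exact: iota_uniq.
Qed.

Lemma generation_embed h f : generation h (embed f) = [set` gens h f].
Proof.
apply/seteqP; split => u /=; first by move=> [fu uh]; rewrite mem_gens fu uh eqxx.
by rewrite mem_gens => /andP[fu /eqP uh]; split.
Qed.

(** [trunc_weight] is defined by recursion on the children of the root, whereas the laws of the
    random trees add one generation at the bottom. *)
Lemma trunc_weight_succ (R : realType) (p : nat -> R) h f :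
  trunc_weight p h.+1 f =
  trunc_weight p h f * \prod_(u <- gens h f) p (size (kids (subtree f u))).
Proof.
elim: h f => [|h IH] f; first by rewrite /= big_seq1 mul1r big1 ?mulr1.
rewrite [LHS]/=; under eq_bigr do rewrite -[p _ * _]/(trunc_weight p h.+1 _) IH.
rewrite big_split mulrA; congr (_ * _).
rewrite (big_nth fleaf) /= big_flatten big_map; apply: eq_bigr => i _.
by rewrite big_map.
Qed.

(** * Protected nodes as words *)

Fixpoint pnodes (t : ftree) : seq (seq nat) :=
  let: Node l := t in
  (if (l != [::]) && (fleaf \notin l) then [:: [::]] else [::]) ++
  (let r := map pnodes l in
   flatten [seq [seq i.+1 :: u | u <- nth [::] r i] | i <- index_iota 0 (size l)]).

(** The definition recurses through [map pnodes l] to satisfy the guard condition. *)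
Lemma pnodesE l : pnodes (Node l) =
  (if (l != [::]) && (fleaf \notin l) then [:: [::]] else [::]) ++
  flatten [seq [seq i.+1 :: u | u <- pnodes (nth fleaf l i)] | i <- index_iota 0 (size l)].
Proof.
rewrite /= ; congr (_ ++ flatten _); apply/eq_in_map => i.
by rewrite mem_index_iota /= => il; rewrite (nth_map fleaf).
Qed.

Lemma size_pnodes t : size (pnodes t) = nprot t.
Proof.
elim/ftree_ind': t => l IH; rewrite pnodesE nprotE size_cat; congr addn; first by case: ifP.
rewrite size_flatten /shape -map_comp sumnE big_map (big_nth fleaf) !big_nat.
by apply: eq_bigr => i /= il; rewrite size_map IH// mem_nth.
Qed.

Lemma uniq_pnodes t : uniq (pnodes t).
Proof.
elim/ftree_ind': t => l IH; rewrite pnodesE cat_uniq; apply/and3P; split.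
- by case: ifP.
- apply/hasPn => _ /flatten_mapP[i _ /mapP[u _ ->]]; by case: ifP.
- pose F i := if (i < size l)%N then pnodes (nth fleaf l i) else [::].
  rewrite (_ : map _ _ = [seq [seq i.+1 :: u | u <- F i] | i <- index_iota 0 (size l)]);
    last first.
    by apply/eq_in_map => i; rewrite mem_index_iota /= /F => ->.
  apply: uniq_flatten_cons => //; first exact: iota_uniq.
  by move=> i; rewrite /F; case: ifP => // il; apply: IH; exact: mem_nth.
Qed.

Lemma mem_pnodes t u : (u \in pnodes t) =
  [&& fmem t u, kids (subtree t u) != [::] & fleaf \notin kids (subtree t u)].
Proof.
elim/ftree_ind': t u => l IH u; rewrite pnodesE mem_cat.
case: u => [|i u] /=.
  have -> : [::] \in flatten [seq [seq i.+1 :: u | u <- pnodes (nth fleaf l i)]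
      | i <- index_iota 0 (size l)] = false.
    by apply/negbTE/flatten_mapP => -[i _ /mapP[]].
  by rewrite orbF; case: ifP.
have -> : i :: u \in (if (l != [::]) && (fleaf \notin l) then [:: [::]] else [::]) = false.
  by case: ifP.
apply/flatten_mapP/idP => [[j]|].
  rewrite mem_index_iota /= => jl /mapP[v + [-> ->]] /=.
  by rewrite IH ?mem_nth// jl.
case: i => // i /andP[/andP[il fu] h]; exists i; first by rewrite mem_index_iota.
by apply/mapP; exists u => //; rewrite IH ?mem_nth// fu.
Qed.

Lemma leaf_embed f u : leaf (embed f) u <-> fmem f u /\ subtree f u = fleaf.
Proof.
split=> [[/= fu]|[fu e]].
  by rewrite nchild_embed// => -[/size0nil e]; split=> //; case: (subtree f u) e => l /= ->.
by split=> //; rewrite nchild_embed// e.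
Qed.

Lemma subtree_rcons t u i :
  subtree t (rcons u i) = nth fleaf (kids (subtree t u)) i.-1.
Proof. by elim: u t => //= j u IH t. Qed.

Lemma protected_embed f : [set u | protected_node (embed f) u] = [set` pnodes f].
Proof.
apply/seteqP; split => u; rewrite /= mem_pnodes.
  move=> [/= fu /leaf_embed nl nc]; rewrite fu /=; apply/andP; split.
    by apply/eqP => e; apply: nl; split=> //; case: (subtree f u) e => l /= ->.
  apply/negP => /(nthP fleaf)[i il e]; apply: (nc i.+1); first by rewrite nchild_embed.
  by apply/leaf_embed; rewrite fmem_rcons subtree_rcons fu.
move=> /and3P[fu k0 lk]; split=> //=; first by move=> /leaf_embed[_ e]; rewrite e in k0.
move=> i /andP[i0]; rewrite nchild_embed// lez_nat => il /leaf_embed[_].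
rewrite subtree_rcons => e; move/negP: lk; apply.
by rewrite -e; apply: mem_nth; rewrite prednK.
Qed.

Lemma card_set_seq (T : choiceType) (r : seq T) : uniq r ->
  ([set` r] #= `I_(size r))%card.
Proof.
case: r => [_|x0 r ur]; first by rewrite (_ : [set` [::]] = set0) ?II0//; apply/seteqP; split.
rewrite (_ : [set` x0 :: r] = nth x0 (x0 :: r) @` `I_(size (x0 :: r))).
  apply: inj_card_eq => i j; rewrite !inE /= => ir jr /eqP.
  by rewrite nth_uniq// => /eqP.
apply/seteqP; split => x /=.
  by move=> /(nthP x0)[i ir <-]; exists i.
by move=> [i ir <-]; exact: mem_nth.
Qed.

(** The cardinality is expressed with finite lists of words, of which there are countably many;
    measurability follows from this form. *)
Lemma nb_protected_seq (t : tree) n : nb_protected_eq t n <->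
  exists r : seq (seq nat),
    [/\ uniq r, size r = n & [set u | protected_node t u] = [set` r]].
Proof.
split=> [tn|[r [ur <- e]]]; last by rewrite /nb_protected_eq e; exact: card_set_seq.
have /finite_seqP[s e] : finite_set [set u | protected_node t u].
  by apply/finite_setP; exists n.
have {}e : [set u | protected_node t u] = [set` undup s].
  by rewrite e; apply/seteqP; split => u /=; rewrite mem_undup.
exists (undup s); split=> //; first exact: undup_uniq.
move: tn; rewrite /nb_protected_eq e (card_eql (card_set_seq (undup_uniq s))).
by move=> /card_eq_II.
Qed.

Lemma nb_protected_embed f n : nb_protected_eq (embed f) n <-> nprot f = n.
Proof.
rewrite /nb_protected_eq protected_embed -(size_pnodes f).
rewrite (card_eql (card_set_seq (uniq_pnodes f))).
by split => [/card_eq_II|->//].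
Qed.

(** * Local topology and measurability *)

Lemma open_nchild u z : open [set t : tree | nchild t u = z].
Proof.
exists ((fun g : seq nat -> int => g u) @^-1` [set z]) => //.
have pc := (@continuousP {ptws seq nat -> discrete_topology int} _ _).1
  (@proj_continuous (seq nat) (fun=> discrete_topology int) u).
by apply: pc; exact: discrete_open.
Qed.

Lemma open_nchild_seq (r : seq (seq nat)) (m : seq nat -> int) :
  open [set t : tree | forall u, u \in r -> nchild t u = m u].
Proof.
elim: r => [|v r IH].
  by rewrite (_ : mkset _ = setT); [exact: openT|apply/seteqP; split].
rewrite (_ : mkset _ = [set t | nchild t v = m v] `&`
   [set t : tree | forall u, u \in r -> nchild t u = m u]).
  by apply: openI => //; exact: open_nchild.
apply/seteqP; split => t /=.
  by move=> h; split=> [|u ur]; apply: h; rewrite inE ?eqxx// ur orbT.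
by move=> [h1 h2] u; rewrite inE => /predU1P[->|/h2].
Qed.

Definition ball_tree (h : nat) (f : ftree) : set tree :=
  [set t | trunc h t = trunc h (embed f)].

Lemma ball_tree0 f : ball_tree 0 f = setT.
Proof.
apply/seteqP; split => // t _; apply/truncP => -[|//] _.
by split=> _; exact: tree_root.
Qed.

Lemma ball_treeS h f : ball_tree h.+1 f = ball_tree h f `&`
  [set t | forall u, u \in gens h f -> nchild t u = nchild (embed f) u].
Proof.
apply/seteqP; split => t; rewrite /ball_tree /= trunc_succ => -[h1 h2]; split => // u.
  by move=> uf; apply: h2; rewrite generation_embed.
by rewrite generation_embed; exact: h2.
Qed.

Lemma open_ball_tree h f : open (ball_tree h f).
Proof.
elim: h => [|h IH]; first by rewrite ball_tree0; exact: openT.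
by rewrite ball_treeS; apply: openI => //; exact: open_nchild_seq.
Qed.

Lemma open_measurable_tree (U : set tree) : open U -> measurable U.
Proof. by move=> oU; apply: sub_sigma_algebra. Qed.

Lemma measurable_ball_tree h f : measurable (ball_tree h f).
Proof. by apply: open_measurable_tree; exact: open_ball_tree. Qed.

Lemma countType_bigcup_measurable d (T : sigmaRingType d) (I : countType)
    (D : set I) (F : I -> set T) :
  (forall i, D i -> measurable (F i)) -> measurable (\bigcup_(i in D) F i).
Proof.
move=> mF; rewrite bigcup_mkcond; apply: countable_bigcupT_measurable => [|i].
  exact: countableP.
by case: ifPn => // /set_mem; exact: mF.
Qed.

Lemma countType_bigcap_measurable d (T : measurableType d) (I : countType)
    (F : I -> set T) :
  (forall i, measurable (F i)) -> measurable (\bigcap_i F i).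
Proof.
move=> mF; rewrite -[X in measurable X]setCK setC_bigcap; apply: measurableC.
by apply: countType_bigcup_measurable => i _; exact: measurableC.
Qed.

Lemma measurable_nchild u (B : set int) : measurable [set t : tree | B (nchild t u)].
Proof.
rewrite (_ : mkset _ = \bigcup_(z in B) [set t : tree | nchild t u = z]).
  apply: countType_bigcup_measurable => z _.
  by apply: open_measurable_tree; exact: open_nchild.
by apply/seteqP; split => t /=; [move=> Bt; exists (nchild t u)|move=> [z Bz ->]].
Qed.

Lemma leafE (t : tree) u : leaf t u <-> nchild t u = 0.
Proof. by split=> [[]//|e]; split=> //; apply/nchild_ge0; rewrite e. Qed.

Lemma measurable_protected u : measurable [set t : tree | protected_node t u].
Proof.
have -> : [set t : tree | protected_node t u] =
  [set t : tree | [set z : int | 0 <= z /\ z <> 0] (nchild t u)] `&`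
  \bigcap_i (~` [set t : tree | [set z : int | (1 <= i)%N && (i%:Z <= z)] (nchild t u)] `|`
            ~` [set t : tree | [set 0 : int] (nchild t (rcons u i))]).
  apply/seteqP; split => t /=.
    move=> [tu nl nc]; split; first by split; [exact/nchild_ge0|move=> /leafE].
    move=> i _ /=; have [/nc h|h] := pselect ((1 <= i)%N && (i%:Z <= nchild t u)); last by left.
    by right=> /leafE.
  move=> [[/nchild_ge0 tu n0] hc]; split=> // [/leafE//|i hi /leafE l0].
  by case: (hc i I).
apply: measurableI; first exact: measurable_nchild.
apply: bigcapT_measurable => i; apply: measurableU; apply: measurableC;
  exact: measurable_nchild.
Qed.

Lemma measurable_nb_protected n : measurable [set t : tree | nb_protected_eq t n].
Proof.
have -> : [set t : tree | nb_protected_eq t n] =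
  \bigcup_(r in [set r : seq (seq nat) | uniq r && (size r == n)])
  \bigcap_u (if u \in r then [set t | protected_node t u]
             else ~` [set t | protected_node t u]).
  apply/seteqP; split => t /=.
    move=> /nb_protected_seq[r [ur <- e]]; exists r; first by rewrite /= ur eqxx.
    move=> u _; have eu : protected_node t u <-> u \in r.
      by have := congr1 (fun A => A u) e => /= ->.
    case: ifP => [ur'|/negP nur] /=; first by apply/eu.
    by move=> /eu.
  move=> [r /= /andP[ur /eqP sr] h]; apply/nb_protected_seq; exists r; split=> //.
  apply/seteqP; split => u /=.
    by have := h u I; case: ifP => //= _ /[apply].
  by move=> ur'; have := h u I; rewrite ur'.
apply: countType_bigcup_measurable => r _.
apply: countType_bigcap_measurable => u.
by case: ifP => _; [|apply: measurableC]; exact: measurable_protected.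
Qed.

(** Otherwise each ball around [t] contains a tree outside [U]; these trees converge pointwise to
    [t], and therefore enter [U]. *)
Lemma nbhs_tree (t : tree) (U : set tree) : nbhs t U ->
  exists h, forall t', trunc h t' = trunc h t -> U t'.
Proof.
move=> [_ [[B oB <-] Bt] BU]; apply: contrapT => hU.
have {}hU h : exists t', trunc h t' = trunc h t /\ ~ U t'.
  apply: contrapT => h1; apply: hU; exists h => t' tt'; apply: contrapT => nU.
  by apply: h1; exists t'.
pose s h := projT1 (cid (hU h)).
have sP h : trunc h (s h) = trunc h t /\ ~ U (s h) := projT2 (cid (hU h)).
have : {ptws, (fun h => nchild_ptws (s h)) @ \oo --> nchild_ptws t}.
  apply/(@pointwise_cvgP (discrete_topology (seq nat)) (discrete_topology int)) => u.
  apply/discrete_cvg; exists (size u).+1 => // h /= uh.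
  by apply: trunc_nchild (sP h).1.
move=> /(_ B); have : nbhs (nchild_ptws t) B by exact: open_nbhs_nbhs.
move=> /[swap] /[apply] -[N _ /(_ N (leqnn _)) /= BN].
by apply: (sP N).2; apply: BU.
Qed.

Lemma continuous_tree (R : realType) (g : tree -> R) : continuous g ->
  forall (eps : R) t, 0 < eps ->
  exists h, forall t', trunc h t' = trunc h t -> `|g t - g t'| <= eps.
Proof.
move=> cg eps t eps0; have /cvgrPdist_le/(_ eps eps0) := cg t.
exact: nbhs_tree.
Qed.

(** * Galton-Watson and Kesten trees *)

Section probability_lemmas.
Context {R : realType} d (Omega : measurableType d) (P : probability Omega R).

(** Turns a conditional probability into a product formula, which also holds, as 0 = 0, when the
    conditioning event is null. *)
Lemma cprobE (A B : set Omega) (c : R) : measurable A -> measurable B ->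
  (P B != 0%E -> cprob P A B = c) -> P (A `&` B) = (c%:E * P B)%E.
Proof.
move=> mA mB cAB; have mAB := measurableI _ _ mA mB.
have [B0|B0] := eqVneq (P B) 0%E.
  rewrite B0 mule0; apply/eqP; rewrite eq_le measure_ge0 andbT -B0.
  by apply: le_measure; rewrite ?inE//; exact: subIsetr.
have fB := fin_num_measure P _ mB; have fAB := fin_num_measure P _ mAB.
have B1 : fine (P B) != 0.
  by apply: contra_neq B0 => e; rewrite -[LHS](fineK fB) e.
by rewrite -(cAB B0) /cprob -{2}(fineK fB) -EFinM mulfVK ?fineK.
Qed.

Variable tau : {mfun Omega >-> tree}.

Lemma measurable_preimage (B : set tree) : measurable B -> measurable (tau @^-1` B).
Proof. by move=> mB; rewrite -[X in measurable X]setTI; exact: measurable_funP. Qed.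

Lemma generation_event h f :
  [set w | forall u, generation h (embed f) u ->
     nchild (tau w) u = (size (kids (subtree f u)))%:Z] =
  tau @^-1` [set t | forall u, u \in gens h f -> nchild t u = nchild (embed f) u].
Proof.
apply/seteqP; split => w /=; rewrite generation_embed => hw u uf.
  by rewrite hw// nchild_embed//; move: uf; rewrite mem_gens => /andP[].
by rewrite hw// nchild_embed//; move: uf; rewrite /= mem_gens => /andP[].
Qed.

Lemma measurable_generation_event h f :
  measurable (tau @^-1` [set t | forall u, u \in gens h f -> nchild t u = nchild (embed f) u]).
Proof.
by apply: measurable_preimage; apply: open_measurable_tree; exact: open_nchild_seq.
Qed.

End probability_lemmas.

Section galton_watson.
Context {R : realType} (p : nat -> R) d (Omega : measurableType d)
  (P : probability Omega R) (tau : {mfun Omega >-> tree}).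
Hypothesis tau_gw : galton_watson p P tau.

Lemma gw_ball h f : P (tau @^-1` ball_tree h f) = (trunc_weight p h f)%:E.
Proof.
elim: h => [|h IH].
  by rewrite ball_tree0 preimage_setT probability_setT.
have := @tau_gw h (embed f) (fun u => size (kids (subtree f u))).
rewrite generation_event => /cprobE.
move=> /(_ (measurable_generation_event _ _ _) (measurable_preimage _ (measurable_ball_tree h f))).
rewrite -[X in (_ * P X)%E]/(tau @^-1` ball_tree h f) IH -EFinM.
rewrite ball_treeS preimage_setI setIC => ->.
by rewrite trunc_weight_succ generation_embed -fsbig_seq ?uniq_gens// mulrC.
Qed.

Lemma gw_embed f : P (tau @^-1` [set embed f]) = (weight p f)%:E.
Proof.
rewrite -(trunc_weight_full p (ltnSn (height f))) -gw_ball.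
by congr (P (_ @^-1` _)); apply/seteqP; split => t /=; rewrite /ball_tree /= trunc_embed.
Qed.

Lemma measurable_embed f : measurable (tau @^-1` [set embed f]).
Proof.
rewrite (_ : [set _] = ball_tree (height f).+1 f).
  by apply: measurable_preimage; exact: measurable_ball_tree.
by apply/seteqP; split => t /=; rewrite /ball_tree /= trunc_embed.
Qed.

(** The events [tau w = embed f] are disjoint for distinct [f] and have probability [weight p f];
    infinite trees of [E] are simply discarded. *)
Lemma psum_weight_le_prob (D : pred ftree) (E : set tree) : measurable E ->
  (forall f, D f -> E (embed f)) ->
  (psum (fun f => weight p f * (D f)%:R)%R <= P (tau @^-1` E))%E.
Proof.
move=> mE DE; apply: psum_le => r ur.
pose U (r : seq ftree) := [set w | has (fun f => D f && (tau w == embed f)) r].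
have Ucons f s : U (f :: s) = (if D f then tau @^-1` [set embed f] else set0) `|` U s.
  apply/seteqP; split => w /=; rewrite /U /=.
    case/orP => [/andP[Df /eqP e]|h]; last by right.
    by left; rewrite Df.
  case=> [|->]; last by rewrite orbT.
  by case: ifP => // Df /= ->; rewrite eqxx.
have mc f : measurable (if D f then tau @^-1` [set embed f] else set0).
  by case: ifP => // _; exact: measurable_embed.
have mU s : measurable (U s).
  elim: s => [|f s IH]; last by rewrite Ucons; exact: measurableU.
  by rewrite (_ : U [::] = set0)//; apply/seteqP; split.
suff <- : P (U r) = (\sum_(f <- r) weight p f * (D f)%:R)%:E.
  apply: le_measure; rewrite ?inE//; first exact: measurable_preimage.
  by move=> w /hasP[f _ /andP[/DE Df /eqP e]]; rewrite /= e.
elim: r ur => [|f s IH] /=.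
  by rewrite big_nil (_ : U [::] = set0) ?measure0//; apply/seteqP; split.
move=> /andP[fs us]; rewrite big_cons EFinD -IH// Ucons measureU//.
  congr (_ + _)%E; case: ifP => _; last by rewrite mulr0 measure0.
  by rewrite mulr1; exact: gw_embed.
apply/seteqP; split => // w [].
case: ifP => // _ /= e /hasP[g gs /andP[_ /eqP]]; rewrite e => /embed_inj fg.
by rewrite fg gs in fs.
Qed.

Hypothesis p_ge0 : forall n, 0 <= p n.
Hypothesis p_sum1 : psum p = 1%E.
Hypothesis p_critical : psum (fun n => n%:R * p n) = 1%E.
Variable k : nat.
Hypothesis k_gt1 : (1 < k)%N.
Hypothesis pk_gt0 : 0 < p k.

Local Notation event n := (tau @^-1` [set t | nb_protected_eq t n]).

(* The upper bound comes from the complementary event and almost sure extinction. *)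
Lemma prob_nb_protected n : P (event n) = (mass p n)%:E.
Proof.
have mE := measurable_preimage tau (measurable_nb_protected n).
have mEc := measurableC (measurable_nb_protected n).
have lo := @psum_weight_le_prob (fun f => nprot f == n) _ (measurable_nb_protected n).
have hi := @psum_weight_le_prob (fun f => nprot f != n) _ mEc.
have {}lo := lo (fun f h => (nb_protected_embed f n).2 (eqP h)).
have {}hi : (psum (fun f => weight p f * (nprot f != n)%:R)%R <= P (~` event n))%E.
  by apply: hi => f /eqP h /nb_protected_embed.
have w0 f (b : bool) : 0 <= weight p f * b%:R by rewrite mulr_ge0// weight_ge0.
have : (psum (fun f => weight p f * (nprot f == n)%:R)%R +
        psum (fun f => weight p f * (nprot f != n)%:R)%R = 1)%E.
  rewrite -psumD// -(psum_weight p_ge0 p_sum1 p_critical k_gt1 pk_gt0).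
  by apply: eq_psum => f; rewrite -mulrDr; case: eqP => _; rewrite ?addr0 ?add0r mulr1.
rewrite probability_setC// in hi.
rewrite (massE p_ge0 p_sum1 p_critical k_gt1 pk_gt0) in lo *.
have := fin_num_measure P _ mE; move: lo hi.
have := psum_ge0 (fun f => w0 f (nprot f != n)).
case: (P _) => [a| |]//; case: (psum _) => [b| |]//.
rewrite -EFinB -EFinD !lee_fin => b0 h1 h2 _ [h3].
by apply/eqP; rewrite eqe; apply/eqP; lra.
Qed.

Lemma prob_ball_nb_protected h f n :
  ((ball_mass p h f n)%:E <= P (tau @^-1` ball_tree h f `&` event n))%E.
Proof.
rewrite -(ball_massE p_ge0 p_sum1 p_critical k_gt1 pk_gt0) -preimage_setI.
apply: psum_weight_le_prob.
  by apply: measurableI; [exact: measurable_ball_tree|exact: measurable_nb_protected].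
move=> g /andP[fg /eqP gn]; split; first exact: agree_trunc.
exact/nb_protected_embed.
Qed.

End galton_watson.

Section kesten.
Context {R : realType} (p : nat -> R) d (Omega : measurableType d)
  (P : probability Omega R) (tau : {mfun Omega >-> tree})
  (v : nat -> {mfun Omega >-> nat}).
Hypothesis tau_kesten : kesten_tree p P tau v.
Hypothesis mean1 : mean p = 1.

Local Notation spine_is h x := [set w | spine v h w = x].

Lemma measurable_letter k i : measurable [set w | v k w = i].
Proof.
rewrite (_ : mkset _ = v k @^-1` [set i])//.
by rewrite -[X in measurable X]setTI; exact: measurable_funP.
Qed.

Lemma spineS h w : spine v h.+1 w = rcons (spine v h w) (v h w).
Proof. by rewrite /spine mkseqS. Qed.

Lemma measurable_spine h x : measurable (spine_is h x).
Proof.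
elim: h x => [|h IH] x.
  have [->|x0] := eqVneq x [::].
    by rewrite (_ : mkset _ = setT)//; apply/seteqP; split.
  by rewrite (_ : mkset _ = set0)//; apply/seteqP; split => // w /= e; rewrite -e in x0.
case/lastP: x => [|x i].
  by rewrite (_ : mkset _ = set0)//; apply/seteqP; split => // w /=; rewrite spineS; case: spine.
rewrite (_ : mkset _ = spine_is h x `&` [set w | v h w = i]).
  by apply: measurableI; [exact: IH|exact: measurable_letter].
apply/seteqP; split => w /=; rewrite spineS.
  by move/rcons_inj => -[].
by move=> [-> ->].
Qed.

(** The size-biased law puts a factor [m] at the spine vertex, and the uniform choice of the next
    one divides by [m]. So every vertex of generation [h] is equally likely to be on the spine, with
    the Galton-Watson weight of the ball. *)
Lemma kesten_ball_spine h f x : x \in gens h f ->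
  P (tau @^-1` ball_tree h f `&` spine_is h x) = (trunc_weight p h f)%:E.
Proof.
elim: h x => [|h IH] x.
  rewrite inE => /eqP ->; rewrite ball_tree0 preimage_setT setTI.
  rewrite (_ : mkset _ = setT) ?probability_setT//.
  by apply/seteqP; split.
have mb j := measurable_preimage tau (measurable_ball_tree j f).
rewrite mem_gens; case/lastP: x => [|x i]; first by rewrite andbF.
rewrite fmem_rcons size_rcons eqSS => /andP[/andP[fx ix] xh].
have xg : x \in gens h f by rewrite mem_gens fx.
set m := size _ in ix.
have := @kesten_children _ _ _ _ _ _ _ tau_kesten h (embed f) x
  (fun u => size (kids (subtree f u))).
rewrite generation_event => /cprobE.
move=> /(_ (measurable_generation_event _ _ _)
  (measurableI _ _ (mb h) (measurable_spine h x))).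
rewrite -[X in (_ * P X)%E]/(tau @^-1` ball_tree h f `&` spine_is h x) IH// -EFinM.
rewrite generation_embed -fsbig_seq ?uniq_gens//.
have -> : \prod_(u <- gens h f) (if u == x then
     size_biased p (size (kids (subtree f u))) else p (size (kids (subtree f u)))) =
    m%:R * \prod_(u <- gens h f) p (size (kids (subtree f u))).
  rewrite (bigD1_seq x) ?uniq_gens//= eqxx [X in _ = _ * X](bigD1_seq x) ?uniq_gens//=.
  rewrite /size_biased mean1 divr1 mulrA; congr (_ * _).
  by apply: eq_bigr => u /negbTE ->.
move=> ball_x.
have {}ball_x : P (tau @^-1` ball_tree h.+1 f `&` spine_is h x) =
    (m%:R * \prod_(u <- gens h f) p (size (kids (subtree f u))) *
     trunc_weight p h f)%:E.
  by rewrite ball_treeS preimage_setI -setIA setICA; exact: ball_x.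
have := @kesten_next _ _ _ _ _ _ _ tau_kesten h (embed f) x i => /cprobE.
move=> /(_ (measurable_letter h i) (measurableI _ _ (mb h.+1) (measurable_spine h x))).
rewrite -[X in (_ * P X)%E]/(tau @^-1` ball_tree h.+1 f `&` spine_is h x) ball_x -EFinM.
rewrite nchild_embed// -/m lez_nat ix.
have -> : tau @^-1` ball_tree h.+1 f `&` spine_is h.+1 (rcons x i) =
    [set w | v h w = i] `&` (tau @^-1` ball_tree h.+1 f `&` spine_is h x).
  apply/seteqP; split => w /=; rewrite spineS.
    by move=> [? /rcons_inj[-> ->]].
  by move=> [-> [? ->]].
move=> e; rewrite [LHS]e; congr EFin; rewrite trunc_weight_succ.
(* [m] is nonzero because the letter [i] lies between 1 and [m]. *)
have m0 : m%:R != 0 :> R by rewrite pnatr_eq0; case: (m) ix; case: (i).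
rewrite -[m%:Z%:~R]/(m%:R) -mulrA mulKf// mulrC//.
Qed.

(** Almost surely the spine crosses generation [h] at one of its vertices, so the ball is covered by
    [size (gens h f)] events of equal probability. An upper bound suffices, as it is compared with a
    lower bound for the conditioned trees. *)
Lemma kesten_ball h f :
  (P (tau @^-1` ball_tree h f) <= ((size (gens h f))%:R * trunc_weight p h f)%:E)%E.
Proof.
have mb := measurable_preimage tau (measurable_ball_tree h f).
have [N [mN N0 hN]] := kesten_spine tau_kesten.
pose U (r : seq (seq nat)) := [set w | ball_tree h f (tau w) /\ spine v h w \in r].
have Ucons x r : U (x :: r) = (tau @^-1` ball_tree h f `&` spine_is h x) `|` U r.
  apply/seteqP; split => w; rewrite /U /= inE.
    by move=> [tw /predU1P[e|wr]]; [left|right].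
  by move=> [[tw ->]|[tw wr]]; split=> //; rewrite ?eqxx// wr orbT.
have mU r : measurable (U r).
  elim: r => [|x r IH].
    by rewrite (_ : U [::] = set0)//; apply/seteqP; split => // w [].
  by rewrite Ucons; apply: measurableU => //; apply: measurableI => //; exact: measurable_spine.
have UP r : {subset r <= gens h f} -> (P (U r) <= ((size r)%:R * trunc_weight p h f)%:E)%E.
  elim: r => [|x r IH] rs.
    by rewrite (_ : U [::] = set0) ?measure0 ?mul0r//; apply/seteqP; split => // w [].
  rewrite Ucons /= -nat1r mulrDl mul1r EFinD.
  apply: le_trans (measureU2 _ _ _) _ => //.
    by apply: measurableI => //; exact: measurable_spine.
  apply: leeD; first (rewrite le_eqVlt; apply/orP; left; apply/eqP; apply: kesten_ball_spine).
    by rewrite rs// mem_head.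
  by apply: IH => y yr; apply: rs; rewrite inE yr orbT.
apply: le_trans (UP (gens h f) (fun _ => id)).
rewrite -[leRHS]add0e -N0; apply: le_trans (measureU2 _ mN (mU _)).
apply: le_measure; rewrite ?inE//; first exact: measurableU.
move=> w tw; have [Nw|Nw] := pselect (N w); [by left|right].
split=> //; have [+ _] : (forall h, tau w (spine v h w)) /\
    (forall v' : nat -> nat, (forall h, tau w (mkseq v' h)) ->
       forall k, v' k = v k w).
  by apply: contrapT => h1; apply: Nw; apply: hN.
move=> /(_ h) sp; rewrite mem_gens size_mkseq eqxx andbT.
by move/truncP: tw => /(_ (spine v h w)); rewrite size_mkseq => /(_ (leqnn _))[/(_ sp)].
Qed.

End kesten.

(** * Convergence in law from lower bounds on balls *)

Section integrals.
Context {R : realType} d (T : measurableType d) (nu : probability T R).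

Lemma bounded_integrable (g : T -> R) (M : R) : measurable_fun setT g ->
  (forall t, `|g t| <= M) -> nu.-integrable setT (EFin \o g).
Proof.
move=> mg gM; apply: measurable_bounded_integrable => //.
  by rewrite (le_lt_trans (probability_le1 _ _))// ltry.
exists M; split; first exact: num_real.
by move=> x Mx t _; exact: le_trans (gM t) (ltW Mx).
Qed.

Lemma indic_integrable (A : set T) : measurable A ->
  nu.-integrable setT (EFin \o (\1_A : T -> R)).
Proof.
move=> mA; apply: (@bounded_integrable _ 1); first exact: measurable_indic.
by move=> t; rewrite indicE ger0_norm// lern1 leq_b1.
Qed.

Lemma Rintegral_indic (A : set T) : measurable A ->
  \int[nu]_t (\1_A t : R) = fine (nu A).
Proof. by move=> mA; rewrite /Rintegral integral_indic// setIT. Qed.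

Lemma Rintegral_prob_cst (C : R) : \int[nu]_t cst C t = C.
Proof.
have h : fine (nu setT) = 1 by rewrite probability_setT.
by rewrite Rintegral_cst// -[RHS]mulr1; congr (_ * _); exact: h.
Qed.

Lemma step_integrable (I : Type) (r : seq I) (c : I -> R) (A : I -> set T) :
  (forall i, measurable (A i)) ->
  nu.-integrable setT (EFin \o (fun t => \sum_(i <- r) c i * \1_(A i) t)).
Proof.
move=> mA; rewrite (_ : _ \o _ = fun t => (\sum_(i <- r) (c i)%:E * (\1_(A i) t)%:E)%E).
  apply: integrable_sum => // i _; apply: integrableZl => //.
  exact: indic_integrable.
by apply/funext => t /=; rewrite sumEFin.
Qed.

Lemma Rintegral_step (I : Type) (r : seq I) (c : I -> R) (A : I -> set T) :
  (forall i, measurable (A i)) ->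
  \int[nu]_t (\sum_(i <- r) c i * \1_(A i) t) = \sum_(i <- r) c i * fine (nu (A i)).
Proof.
move=> mA; elim: r => [|i r IH].
  under eq_Rintegral do rewrite big_nil.
  by rewrite Rintegral_cst// mul0r big_nil.
under eq_Rintegral do rewrite big_cons.
rewrite RintegralD//; last exact: step_integrable.
  rewrite big_cons IH RintegralZl ?Rintegral_indic//; exact: indic_integrable.
have := step_integrable [:: i] c mA; congr (integrable _ _ (_ \o _)).
by apply/funext => t; rewrite big_seq1.
Qed.

End integrals.

Lemma measurable_fun_tree (R : realType) (g : tree -> R) : continuous g ->
  measurable_fun setT g.
Proof.
move=> cg; apply: (measurability _ (RGenOInfty.measurableE R)) => //.
move=> _ [_ [x ->] <-]; rewrite setTI; apply: open_measurable_tree.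
by move/continuousP: cg; apply; exact: rray_open.
Qed.

(** For fixed [h] the nonempty fibers partition the trees, while different [f] may give the same
    [ball_tree h f]. *)
Definition fiber (h : nat) (f : ftree) : set tree := [set t | cut h t [::] = f].

Lemma fiber_cut h (s t : tree) : fiber h (cut h s [::]) t <-> trunc h t = trunc h s.
Proof. exact: cut_eq. Qed.

Lemma fiberE h f : fiber h f = ball_tree h f \/ fiber h f = set0.
Proof.
have [e|e] := eqVneq (cut h (embed f) [::]) f.
  by left; apply/seteqP; split => t; rewrite /fiber /ball_tree /= -cut_eq e.
right; apply/seteqP; split => // t; rewrite /fiber /= => tf; move/eqP: e; apply.
by rewrite -[RHS]tf; apply/cut_eq; rewrite -tf trunc_cut.
Qed.

Lemma fiber_embed h f t : fiber h f t -> fiber h f (embed f).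
Proof. by rewrite /fiber /= => <-; apply/cut_eq; rewrite trunc_cut. Qed.

Lemma measurable_fiber h f : measurable (fiber h f).
Proof. by have [->|->] := fiberE h f; first exact: measurable_ball_tree. Qed.

Section portmanteau.
Context {R : realType} (nu : nat -> probability tree R) (nu_lim : probability tree R).
Hypothesis ball_lower : forall h f (eps : R), 0 < eps ->
  exists N, forall n, (N <= n)%N ->
    fine (nu_lim (ball_tree h f)) <= fine (nu n (ball_tree h f)) + eps.

Lemma fiber_lower h f (eps : R) : 0 < eps ->
  exists N, forall n, (N <= n)%N ->
    fine (nu_lim (fiber h f)) <= fine (nu n (fiber h f)) + eps.
Proof.
have [->|->] := fiberE h f; first exact: ball_lower.
by move=> eps0; exists 0%N => n _; rewrite !measure0 add0r ltW.
Qed.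

Lemma nondecreasing_large (F : nat -> set tree) (e : R) : 0 < e ->
  (forall i, measurable (F i)) -> nondecreasing_seq F ->
  (measurable (\bigcup_i F i)) ->
  exists i, fine (nu_lim (\bigcup_i F i)) - e < fine (nu_lim (F i)).
Proof.
move=> e0 mF ndF mU.
have : nu_lim \o F @ \oo --> (fine (nu_lim (\bigcup_i F i)))%:E.
  by rewrite fineK ?fin_num_measure//; exact: nondecreasing_cvg_mu.
move=> /fine_cvg /cvgrPdist_lt/(_ e e0)[N _ /(_ N (leqnn _))] /= h.
by exists N; move: h; rewrite ltr_norml => /andP[]; lra.
Qed.

(* On finitely many balls carrying almost all the mass of [nu_lim], [g] is almost constant. *)
Lemma integral_lower (g : tree -> R) (C eps : R) : continuous g ->
  (forall t, 0 <= g t <= C) -> 0 < eps ->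
  exists N, forall n, (N <= n)%N ->
    \int[nu_lim]_t g t <= \int[nu n]_t g t + eps.
Proof.
move=> cg g0C eps0.
have g0 t : 0 <= g t by case/andP: (g0C t).
have gC t : g t <= C by case/andP: (g0C t).
have C0 : 0 <= C by apply: le_trans (g0 (embed fleaf)) (gC _).
(* The losses add up to [(3 + 2 * C) * e]: [2 * e] between [g] and the step function, [C * (2 * e)]
   off the chosen fibers, and [e] from the finitely many lower bounds. *)
pose e := eps / (4 + 2 * C).
have e0 : 0 < e by rewrite divr_gt0//; lra.
pose good h f := `[< forall t t', fiber h f t -> fiber h f t' -> `|g t - g t'| <= e >].
(* The union of the fibers on which [g] varies by at most [e]; by continuity these sets increase to
   the whole space. *)
pose G h := [set t | good h (cut h t [::])].
have mG h : measurable (G h).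
  rewrite (_ : G h = \bigcup_(f in [set f | good h f]) fiber h f).
    by apply: countType_bigcup_measurable => f _; exact: measurable_fiber.
  apply/seteqP; split => t /=; first by move=> Gt; exists (cut h t [::]).
  by move=> [f gf]; rewrite /fiber /G /= => ->.
have ndG : nondecreasing_seq G.
  apply/nondecreasing_seqP => h; apply/subsetPset => t /asboolP Gt.
  apply/asboolP => t1 t2 /fiber_cut h1 /fiber_cut h2.
  by apply: Gt; apply/fiber_cut; [move: h1|move: h2]; apply: trunc_le.
have GT : \bigcup_h G h = setT.
  apply/seteqP; split => // t _.
  have e2 : 0 < e / 2 by lra.
  have [h ht] := continuous_tree cg t e2.
  exists h => //; apply/asboolP => t1 t2 /fiber_cut /ht h1 /fiber_cut /ht h2.
  have -> : g t1 - g t2 = (g t - g t2) - (g t - g t1) by lra.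
  by apply: le_trans (ler_normB _ _) _; lra.
have [h Gh] : exists h, 1 - e < fine (nu_lim (G h)).
  have := nondecreasing_large e0 mG ndG; rewrite GT probability_setT.
  by apply; exact: measurableT.
(* Keeping only the good fibers of index less than [K] leaves finitely many, listed in [r]. *)
pose V K := [set t | good h (cut h t [::]) /\ (pickle (cut h t [::]) < K)%N].
have mV K : measurable (V K).
  rewrite (_ : V K = \bigcup_(f in [set f | good h f /\ (pickle f < K)%N]) fiber h f).
    by apply: countType_bigcup_measurable => f _; exact: measurable_fiber.
  apply/seteqP; split => t /=; first by move=> Gt; exists (cut h t [::]).
  by move=> [f gf]; rewrite /fiber /V /= => ->.
have ndV : nondecreasing_seq V.
  apply/nondecreasing_seqP => K; apply/subsetPset => t [gt tK]; split => //.
  exact: ltnW.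
have VG : \bigcup_K V K = G h.
  apply/seteqP; split => t; first by move=> [K _ []].
  by move=> Gt; exists (pickle (cut h t [::])).+1.
have [K VK] : exists K, fine (nu_lim (G h)) - e < fine (nu_lim (V K)).
  by have := nondecreasing_large e0 mV ndV; rewrite VG; apply.
pose r := [seq f <- undup (pmap pickle_inv (iota 0 K)) | good h f].
have mem_r f : (f \in r) = good h f && (pickle f < K)%N.
  rewrite mem_filter mem_undup mem_pmap; congr (_ && _).
  apply/mapP/idP => [[i]|fK].
    by rewrite mem_iota add0n /= => iK e'; have := @pickle_invK ftree i; rewrite -e' /= => ->.
  by exists (pickle f); rewrite ?mem_iota// pickleK_inv.
have ur : uniq r by rewrite filter_uniq// undup_uniq.
(* A lower bound of [g] on a good fiber, truncated at 0 so that it can multiply the lower bounds on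
   probabilities. *)
pose c f := Num.max 0 (g (embed f) - e).
have c0 f : 0 <= c f by rewrite le_max lexx.
pose phi t := \sum_(f <- r) c f * \1_(fiber h f) t.
have phiE t : phi t = if cut h t [::] \in r then c (cut h t [::]) else 0.
  have z f : f != cut h t [::] -> c f * \1_(fiber h f) t = 0.
    move=> ft; rewrite indicE memNset ?mulr0// /fiber /= => e'.
    by rewrite e' eqxx in ft.
  case: ifP => tr.
    rewrite /phi (bigD1_seq (cut h t [::]))//= indicE mem_set// mulr1.
    by rewrite big1 ?addr0.
  rewrite /phi big_seq big1// => f fr; apply: z.
  by apply: contraTneq fr => ->; rewrite tr.
have gr t : cut h t [::] \in r -> `|g t - g (embed (cut h t [::]))| <= e.
  rewrite mem_r => /andP[/asboolP gt _]; apply: gt => //.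
  exact: (@fiber_embed _ _ t).
have phi_le t : phi t <= g t.
  rewrite phiE; case: ifP => // /gr; rewrite ler_norml => /andP[h1 h2].
  by rewrite ge_max g0 /=; lra.
have le_phi t : g t <= phi t + (2 * e * \1_setT t + C * \1_(~` V K) t).
  rewrite phiE !indicE in_setT mulr1; case: ifP => tr.
    have := gr _ tr; rewrite ler_norml => /andP[h1 h2].
    have : g (embed (cut h t [::])) - e <= c (cut h t [::]) by rewrite le_max lexx orbT.
    have : 0 <= C * (t \in ~` V K)%:R by rewrite mulr_ge0.
    lra.
  have -> : t \in ~` V K.
    by apply/mem_set => -[gt tK]; move: tr; rewrite mem_r gt tK.
  by have := gC t; rewrite mulr1n; lra.
have mg := measurable_fun_tree cg.
have gi (mu : probability tree R) : mu.-integrable setT (EFin \o g).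
  by apply: (@bounded_integrable _ _ _ _ _ C) => // t; rewrite ger0_norm.
have mf f := measurable_fiber h f.
have mVC := measurableC (mV K).
have lower n : \sum_(f <- r) c f * fine (nu n (fiber h f)) <= \int[nu n]_t g t.
  rewrite -Rintegral_step//.
  apply: le_Rintegral; [exact: measurableT|exact: step_integrable|exact: gi|].
  by move=> t _; exact: phi_le.
have upper : \int[nu_lim]_t g t <= \sum_(f <- r) c f * fine (nu_lim (fiber h f)) +
    (2 * e + C * fine (nu_lim (~` V K))).
  (* The fibers, the constant term and the complement of [V K] are indexed together, so that a
     single step function is integrated. *)
  pose A (i : option ftree + unit) := match i with
    | inl (Some f) => fiber h f | inl None => setT | inr _ => ~` V K end.
  pose c' (i : option ftree + unit) := match i with
    | inl (Some f) => c f | inl None => 2 * e | inr _ => C end.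
  pose r' := [seq inl (Some f) | f <- r] ++ [:: inl None; inr tt].
  have mA i : measurable (A i) by case: i => [[f|]|u] //=.
  have sumE (F : option ftree + unit -> R) : \sum_(i <- r') F i =
      \sum_(f <- r) F (inl (Some f)) + (F (inl None) + F (inr tt)).
    by rewrite big_cat big_map !big_cons big_nil /= addr0.
  apply: le_trans (_ : \int[nu_lim]_t (\sum_(i <- r') c' i * \1_(A i) t) <= _).
    apply: le_Rintegral; [exact: measurableT|exact: gi|exact: step_integrable|].
    by move=> t _; rewrite sumE; exact: le_phi.
  by rewrite Rintegral_step// sumE /= probability_setT mulr1.
have VC : fine (nu_lim (~` V K)) <= 2 * e.
  rewrite probability_setC// fineB ?fin_num_measure//=; lra.
pose S := \sum_(f <- r) c f.
have S0 : 0 <= S by apply: sumr_ge0.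
have dl0 : 0 < e / (S + 1) by rewrite divr_gt0//; lra.
have [N hN] := @eventually_all _ r (fun f n => fine (nu_lim (fiber h f)) <=
  fine (nu n (fiber h f)) + e / (S + 1)) (fun f => fiber_lower h f dl0).
exists N => n /hN hn; apply: le_trans upper _.
have : \sum_(f <- r) c f * fine (nu_lim (fiber h f)) <=
   \sum_(f <- r) c f * fine (nu n (fiber h f)) + e.
  apply: (@le_trans _ _ (\sum_(f <- r) (c f * fine (nu n (fiber h f)) + c f * (e / (S + 1))))).
    by rewrite !big_seq; apply: ler_sum => f fr; rewrite -mulrDr ler_wpM2l// hn.
  rewrite big_split/= lerD2l -mulr_suml -/S mulrCA ler_piMr//; first exact: ltW.
  by rewrite ler_pdivrMr; lra.
have := lower n; have := ler_wpM2l C0 VC.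
have : (4 + 2 * C) * e = eps by rewrite /e mulrC divfK// gt_eqF//; lra.
lra.
Qed.

(** The one-sided bound is applied to [C + f] and to [C - f], both nonnegative, which gives the two
    inequalities of the limit. *)
Lemma cvg_in_law_of_balls : cvg_in_law nu nu_lim.
Proof.
move=> f cf [M [_ hM]].
pose C := `|M| + 1.
have fC t : `|f t| <= C by apply: (hM C) => //; rewrite /C ltr_pwDr// ler_norm.
have fi (mu : probability tree R) : mu.-integrable setT (EFin \o f).
  by apply: (@bounded_integrable _ _ _ _ _ C) => //; exact: measurable_fun_tree.
have ci (mu : probability tree R) : mu.-integrable setT (EFin \o cst C).
  by apply: (@bounded_integrable _ _ _ _ _ `|C|).
have Cint (mu : probability tree R) : \int[mu]_t cst C t = C.
  exact: Rintegral_prob_cst.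
have IntD (mu : probability tree R) : \int[mu]_t (cst C t + f t) = C + \int[mu]_t f t.
  by rewrite (RintegralD measurableT (ci mu) (fi mu)) Cint.
have IntB (mu : probability tree R) : \int[mu]_t (cst C t - f t) = C - \int[mu]_t f t.
  by rewrite (RintegralB measurableT (ci mu) (fi mu)) Cint.
apply/cvgrPdist_le => eps eps0.
have [N1 h1] : exists N, forall n, (N <= n)%N ->
    \int[nu_lim]_t (cst C t + f t) <= \int[nu n]_t (cst C t + f t) + eps.
  apply: (@integral_lower _ (2 * C)) => //.
    by move=> t; apply: (@continuousD _ R^o _ (cst C) f); [exact: cst_continuous|exact: cf].
  by move=> t /=; have := fC t; rewrite ler_norml; lra.
have [N2 h2] : exists N, forall n, (N <= n)%N ->
    \int[nu_lim]_t (cst C t - f t) <= \int[nu n]_t (cst C t - f t) + eps.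
  apply: (@integral_lower _ (2 * C)) => //.
    by move=> t; apply: (@continuousB _ R^o _ (cst C) f); [exact: cst_continuous|exact: cf].
  by move=> t /=; have := fC t; rewrite ler_norml; lra.
exists (maxn N1 N2) => // n /=; rewrite geq_max => /andP[/h1 + /h2].
by rewrite !IntD !IntB ler_norml; lra.
Qed.

End portmanteau.

(** * Convergence of the conditioned trees to Kesten's tree *)

Lemma exists_branching (R : realType) (p : nat -> R) : (forall n, 0 <= p n) ->
  psum p = 1%E -> p 0%N + p 1%N < 1 -> exists2 k, (1 < k)%N & 0 < p k.
Proof.
move=> p_ge0 p_sum1 p01; apply: contrapT => nk.
have p_eq0 k : (1 < k)%N -> p k = 0.
  move=> k1; apply/eqP; rewrite eq_le p_ge0 andbT leNgt; apply/negP => pk.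
  by apply: nk; exists k.
have := p_sum1; rewrite (@eq_psum _ _ _
  (fun n => p 0%N * (n == 0%N)%:R + p 1%N * (n == 1%N)%:R)).
  rewrite psumD; try by move=> n; rewrite mulr_ge0.
  by rewrite !psum_delta// -EFinD => -[e]; rewrite e ltxx in p01.
by move=> [|[|n]] /=; rewrite ?mulr1 ?mulr0 ?addr0 ?add0r// p_eq0.
Qed.

Theorem theorem5p1 (R : realType) (p : nat -> R)
    (p_ge0 : forall n, 0 <= p n)
    (p_sum1 : series p @ \oo --> (1 : R))
    (p0_gt0 : 0 < p 0%N)
    (p01_lt1 : p 0%N + p 1%N < 1)
    (p_critical : series (fun n => n%:R * p n) @ \oo --> (1 : R))
    (d : measure_display) (Omega : measurableType d)
    (P : probability Omega R) (tau : {mfun Omega >-> tree})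
    (tau_gw : galton_watson p P tau)
    (ds : measure_display) (Omega_s : measurableType ds)
    (Ps : probability Omega_s R) (tau_s : {mfun Omega_s >-> tree})
    (v : nat -> {mfun Omega_s >-> nat})
    (tau_s_kesten : kesten_tree p Ps tau_s v)
    (dn : nat -> measure_display)
    (Omega_n : forall n : nat, measurableType (dn n))
    (Pn : forall n : nat, probability (Omega_n n) R)
    (tau_n : forall n : nat, {mfun (Omega_n n) >-> tree})
    (tau_n_cond : forall n : nat,
      conditioned_on_protected P tau n (Pn n) (tau_n n)) :
  cvg_in_law (fun n => distribution (Pn n) (tau_n n)) (distribution Ps tau_s).
Proof.
have sum1 : psum p = 1%E by exact: series_psum.
have np_ge0 n : 0 <= n%:R * p n by rewrite mulr_ge0.
have crit : psum (fun n => n%:R * p n) = 1%E by exact: series_psum.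
have mean1 : mean p = 1 by apply/cvg_lim.
have [k k_gt1 pk_gt0] := exists_branching p_ge0 sum1 p01_lt1.
apply: cvg_in_law_of_balls => h f eps eps0.
(* With all the vertices of generation [h] as [X], the constant obtained is the bound of
   [kesten_ball] on the same ball. *)
have [|N hN] := ball_mass_lower p_ge0 sum1 crit k_gt1 pk_gt0 p0_gt0
  (t := f) (h := h) (uniq_gens h f) _ eps0.
  by move=> x; rewrite mem_gens => /andP[fx /eqP].
exists N => n /hN; set S := _%:R * _ => lower.
have mb := measurable_ball_tree h f.
have m_gt0 := mass_gt0 p_ge0 sum1 crit k_gt1 pk_gt0 p0_gt0 n.
have Pe := prob_nb_protected tau_gw p_ge0 sum1 crit k_gt1 pk_gt0 n.
have star_le : fine (distribution Ps tau_s (ball_tree h f)) <= S.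
  rewrite -lee_fin fineK ?fin_num_measure//.
  exact: (kesten_ball tau_s_kesten).
(* The conditioning event has probability [mass p n > 0], so the hypothesis on [tau_n] applies. *)
have e_neq0 : P [set w | nb_protected_eq (tau w) n] != 0%E.
  by rewrite Pe eqe gt_eqF.
have cond := congr1 fine (tau_n_cond n e_neq0 _ mb).
apply: (@le_trans _ _ (cprob P (tau @^-1` ball_tree h f)
    [set w | nb_protected_eq (tau w) n] + eps)); last first.
  by rewrite lerD2r; have := cond => /= <-.
rewrite /cprob Pe /=.
have := prob_ball_nb_protected tau_gw p_ge0 sum1 crit k_gt1 pk_gt0 h f n.
have me : measurable (tau @^-1` ball_tree h f `&` tau @^-1` [set t | nb_protected_eq t n]).
  apply: measurableI; apply: measurable_preimage => //.
  exact: measurable_nb_protected.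
rewrite -[P (_ `&` _)]fineK ?fin_num_measure// lee_fin => ball_le.
apply: (le_trans star_le); rewrite -lerBlDr ler_pdivlMr//.
exact: le_trans lower ball_le.
Qed.
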